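(* Let $n\ge1$ and let $M$ be a simple Harish-Chandra $\mathfrak{g}_n$-module on which $z$ acts as zero. Then $H_nM=0$, i.e., $M$ is a simple Harish-Chandra $\mathfrak{sp}_{2n}$-module.
   Context: $\mathfrak{sp}_{2n}$ is the Lie algebra of complex $2n\times 2n$ matrices $\begin{pmatrix}A&B\\ C&-A^T\end{pmatrix}$ with $B=B^T$, $C=C^T$. Let $e_1,\dots,e_{2n}$ be the standard basis of $\mathbb{C}^{2n}$. The Heisenberg Lie algebra is $H_n=\mathbb{C}^{2n}\oplus\mathbb{C}z$ with $[e_i,e_{n+i}]=z$ for $1\le i\le n$, $[z,H_n]=0$, other brackets of basis vectors zero (up to antisymmetry). $\mathfrak{g}_n=\mathfrak{sp}_{2n}\ltimes H_n$ with $[X,v]=Xv$, $[X,z]=0$ for $X\in\mathfrak{sp}_{2n}$, $v\in\mathbb{C}^{2n}$. With $e_{ij}$ the matrix units, $h_i=e_{i,i}-e_{n+i,n+i}$, $\mathfrak{h}=\mathrm{span}\{h_1,\dots,h_n\}$ and $\mathfrak{h}_n=\mathfrak{h}\oplus\mathbb{C}z$. A $\mathfrak{g}_n$-module $M$ is a weight module if $M=\bigoplus_{\lambda\in\mathfrak{h}_n^*}M_\lambda$, where $M_\lambda=\{v\in M: hv=\lambda(h)v\ \forall h\in\mathfrak{h}_n\}$; it is a Harish-Chandra module if it is a weight module and all weight spaces $M_\lambda$ are finite-dimensional. Harish-Chandra $\mathfrak{sp}_{2n}$-modules are defined in the same way using $\mathfrak{h}$. *)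

(* Defs.v *)
From HB Require Import structures.
From mathcomp Require Import all_boot all_order all_algebra.
From mathcomp Require Import ring.
From mathcomp Require Import complex.
From mathcomp Require Import boolp classical_sets reals.

Set Implicit Arguments.
Unset Strict Implicit.
Unset Printing Implicit Defensive.

Import GRing.Theory.
Local Open Scope ring_scope.

HB.mixin Record Vector_isLieAlgebra (F : fieldType) L of Vector F L := {
  lieb : L -> L -> L;
  lieb_linearl : forall (a : F) (x y z : L),
    lieb (a *: x + y) z = a *: lieb x z + lieb y z;
  lieb_linearr : forall (a : F) (x y z : L),
    lieb x (a *: y + z) = a *: lieb x y + lieb x z;
  lieb_alt : forall x : L, lieb x x = 0;
  lieb_jacobi : forall x y z : L,
    lieb x (lieb y z) + lieb y (lieb z x) + lieb z (lieb x y) = 0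
}.

(* Finite-dimensional Lie algebras over F. *)
#[short(type="lieAlgType")]
HB.structure Definition LieAlgebra (F : fieldType) :=
  {L of Vector F L & Vector_isLieAlgebra F L}.

(* Modules may be infinite-dimensional. *)
Record lieModule (F : fieldType) (L : lieAlgType F) := LieModule {
  lie_module_sort :> lmodType F;
  act : L -> lie_module_sort -> lie_module_sort;
  act_linearl : forall (a : F) (x y : L) (m : lie_module_sort),
    act (a *: x + y) m = a *: act x m + act y m;
  act_linearr : forall (a : F) (x : L) (m m' : lie_module_sort),
    act x (a *: m + m') = a *: act x m + act x m';
  act_lieb : forall (x y : L) (m : lie_module_sort),
    act (lieb x y) m = act x (act y m) - act y (act x m)
}.

Section Restriction.
Variables (F : fieldType) (K L : lieAlgType F) (f : {linear K -> L}).
Hypothesis f_lieb : forall x y, f (lieb x y) = lieb (f x) (f y).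
Variable M : lieModule L.

Definition res_act (x : K) (m : M) : M := act (f x) m.

Fact res_act_linearl a x y m :
  res_act (a *: x + y) m = a *: res_act x m + res_act y m.
Proof. by rewrite /res_act linearP act_linearl. Qed.

Fact res_act_linearr a x m m' :
  res_act x (a *: m + m') = a *: res_act x m + res_act x m'.
Proof. exact: act_linearr. Qed.

Fact res_act_lieb x y m :
  res_act (lieb x y) m = res_act x (res_act y m) - res_act y (res_act x m).
Proof. by rewrite /res_act f_lieb act_lieb. Qed.

Definition restriction : lieModule K :=
  LieModule res_act_linearl res_act_linearr res_act_lieb.
End Restriction.

Section ModuleNotions.
Variables (F : fieldType) (L : lieAlgType F) (M : lieModule L).
Local Open Scope classical_set_scope.

Definition submodule (U : set M) : Prop :=
  [/\ U 0,
      forall (a : F) (u v : M), U u -> U v -> U (a *: u + v) &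
      forall (x : L) (u : M), U u -> U (act x u)].

Definition simple_module : Prop :=
  (exists m : M, m != 0) /\
  (forall U : set M, submodule U -> U = [set 0] \/ U = setT).

Definition weight_space (h : {vspace L}) (lambda : 'Hom(subvs_of h, F^o)) :
    set M :=
  [set m | forall x : subvs_of h, act (vsval x) m = (lambda x : F) *: m].

(* Here I need not be finite: the sums range over finite uniq sequences. *)
Definition is_direct_sum (I : eqType) (E : I -> set M) : Prop :=
  (forall m : M, exists s : seq I, exists f : I -> M,
     [/\ uniq s, forall i, E i (f i) & m = \sum_(i <- s) f i]) /\
  (forall (s : seq I) (f : I -> M), uniq s -> (forall i, E i (f i)) ->
     \sum_(i <- s) f i = 0 -> forall i, i \in s -> f i = 0).

Definition finite_dim (E : set M) : Prop :=
  exists s : seq M, forall m : M,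
    E m <-> exists c : 'I_(size s) -> F, m = \sum_(i < size s) c i *: s`_i.

Definition weight_module (h : {vspace L}) : Prop :=
  is_direct_sum (@weight_space h).

Definition harish_chandra (h : {vspace L}) : Prop :=
  weight_module h /\
  forall lambda : 'Hom(subvs_of h, F^o), finite_dim (weight_space lambda).

End ModuleNotions.

Local Ltac mxring := apply/matrixP=> ? ?; rewrite !mxE; ring.

Section Symplectic.
Variables (F : fieldType) (n : nat).

Definition sp_ur (X : 'M[F]_(n + n)) : 'M[F]_n := ursubmx X - (ursubmx X)^T.
Definition sp_dl (X : 'M[F]_(n + n)) : 'M[F]_n := dlsubmx X - (dlsubmx X)^T.
Definition sp_diag (X : 'M[F]_(n + n)) : 'M[F]_n := drsubmx X + (ulsubmx X)^T.

Fact sp_ur_linear : linear sp_ur.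
Proof. by move=> a X Y; apply/matrixP=> i j; rewrite !mxE; ring. Qed.
Fact sp_dl_linear : linear sp_dl.
Proof. by move=> a X Y; apply/matrixP=> i j; rewrite !mxE; ring. Qed.
Fact sp_diag_linear : linear sp_diag.
Proof. by move=> a X Y; apply/matrixP=> i j; rewrite !mxE; ring. Qed.

HB.instance Definition _ := GRing.isLinear.Build F _ _ _ sp_ur sp_ur_linear.
HB.instance Definition _ := GRing.isLinear.Build F _ _ _ sp_dl sp_dl_linear.
HB.instance Definition _ := GRing.isLinear.Build F _ _ _ sp_diag sp_diag_linear.

(* The matrices block_mx A B C (- A^T) with B and C symmetric; see sp_spaceP. *)
Definition sp_space : {vspace 'M[F]_(n + n)} :=
  (lker (linfun sp_ur) :&: lker (linfun sp_dl) :&: lker (linfun sp_diag))%VS.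

Lemma sp_spaceP (X : 'M[F]_(n + n)) :
  reflect (exists A B C : 'M[F]_n,
             [/\ B = B^T, C = C^T & X = block_mx A B C (- A^T)])
          (X \in sp_space).
Proof.
rewrite !memv_cap !memv_ker !lfunE /= /sp_ur /sp_dl /sp_diag.
apply: (iffP idP) => [/andP[/andP[/eqP hB /eqP hC] /eqP hA]|].
  exists (ulsubmx X), (ursubmx X), (dlsubmx X); split.
  - exact/subr0_eq.
  - exact/subr0_eq.
  - by move/eqP: hA; rewrite addr_eq0 => /eqP <-; rewrite submxK.
case=> A [B [C [hB hC ->]]].
rewrite block_mxKur block_mxKdl block_mxKdr block_mxKul.
by rewrite -hB -hC !subrr addNr eqxx.
Qed.

Let tD (p q : nat) (A B : 'M[F]_(p, q)) : (A + B)^T = A^T + B^T.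
Proof. exact: linearD. Qed.
Let tN (p q : nat) (A : 'M[F]_(p, q)) : (- A)^T = - A^T.
Proof. exact: linearN. Qed.

Definition sp := subvs_of sp_space.
HB.instance Definition _ := Vector.on sp.

Fact sp_lieb_subproof (X Y : sp) :
  vsval X *m vsval Y - vsval Y *m vsval X \in sp_space.
Proof.
have /sp_spaceP[A [B [C [hB hC ->]]]] := subvsP X.
have /sp_spaceP[A' [B' [C' [hB' hC' ->]]]] := subvsP Y.
apply/sp_spaceP; rewrite !mulmx_block opp_block_mx add_block_mx.
do 3![eexists]; split; last (congr block_mx; first [reflexivity | idtac]).
- rewrite ?(tD, tN, trmx_mul, trmxK) -hB -hB'.
  by rewrite ?(mulmxN, mulNmx); mxring.
- rewrite ?(tD, tN, trmx_mul, trmxK) -hC -hC'.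
  by rewrite ?(mulmxN, mulNmx); mxring.
- rewrite ?(tD, tN, trmx_mul, trmxK) -hB -hB' -hC -hC'.
  by rewrite ?(mulmxN, mulNmx); mxring.
Qed.

Let vsvalP (a : F) (X Y : sp) :
  vsval (a *: X + Y) = a *: vsval X + vsval Y.
Proof. exact: linearP. Qed.

Definition sp_lieb (X Y : sp) : sp := Subvs (sp_lieb_subproof X Y).

Fact sp_lieb_linearl (a : F) (X Y Z : sp) :
  sp_lieb (a *: X + Y) Z = a *: sp_lieb X Z + sp_lieb Y Z.
Proof.
apply: subvs_inj; rewrite vsvalP /= mulmxDl mulmxDr -scalemxAl -scalemxAr.
mxring.
Qed.

Fact sp_lieb_linearr (a : F) (X Y Z : sp) :
  sp_lieb X (a *: Y + Z) = a *: sp_lieb X Y + sp_lieb X Z.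
Proof.
apply: subvs_inj; rewrite vsvalP /= mulmxDl mulmxDr -scalemxAl -scalemxAr.
mxring.
Qed.

Fact sp_lieb_alt (X : sp) : sp_lieb X X = 0.
Proof. by apply: subvs_inj; rewrite /= subrr. Qed.

Fact sp_lieb_jacobi (X Y Z : sp) :
  sp_lieb X (sp_lieb Y Z) + sp_lieb Y (sp_lieb Z X) + sp_lieb Z (sp_lieb X Y)
  = 0.
Proof.
have vD (A B : sp) : vsval (A + B) = vsval A + vsval B by exact: linearD.
apply: subvs_inj; rewrite [LHS]vD vD /=.
rewrite !(mulmxBl, mulmxBr) !mulmxA; mxring.
Qed.

HB.instance Definition _ := Vector_isLieAlgebra.Build F sp
  sp_lieb_linearl sp_lieb_linearr sp_lieb_alt sp_lieb_jacobi.

Fact sp_h_subproof (i : 'I_n) :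
  delta_mx (lshift n i) (lshift n i) - delta_mx (rshift n i) (rshift n i)
  \in sp_space.
Proof.
apply/sp_spaceP; exists (delta_mx i i), 0, 0; split; rewrite ?trmx0 //.
rewrite trmx_delta; apply/matrixP=> j k; rewrite -(splitK j) -(splitK k).
case: (split j) => j'; case: (split k) => k' /=;
  rewrite ?(block_mxEul, block_mxEur, block_mxEdl, block_mxEdr) !mxE
    ?eq_lshift ?eq_rshift ?eq_lrshift ?eq_rlshift ?andbF /= ?subr0 ?sub0r //.
Qed.

Definition sp_h (i : 'I_n) : sp := Subvs (sp_h_subproof i).

Definition sp_cartan : {vspace sp} := <<[seq sp_h i | i : 'I_n]>>%VS.

End Symplectic.

Section Heisenberg.
Variables (F : fieldType) (n : nat).

(* (v, c) stands for v + c z. *)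
Definition heis := ('cV[F]_(n + n) * F^o)%type.
HB.instance Definition _ := Vector.on heis.

(* The bilinear form with omega e_i e_(n+i) = 1 = - omega e_(n+i) e_i,
   vanishing on the other pairs of basis vectors. *)
Definition omega (v w : 'cV[F]_(n + n)) : F :=
  \sum_(i < n) (v (lshift n i) 0 * w (rshift n i) 0
                - v (rshift n i) 0 * w (lshift n i) 0).

Definition heis_lieb (x y : heis) : heis := (0, omega x.1 y.1).

Lemma omega_linearl a u v w :
  omega (a *: u + v) w = a * omega u w + omega v w.
Proof.
rewrite /omega mulr_sumr -big_split; apply: eq_bigr => i _ /=.
by rewrite !mxE; ring.
Qed.

Lemma omega_linearr a u v w :
  omega u (a *: v + w) = a * omega u v + omega u w.
Proof.
rewrite /omega mulr_sumr -big_split; apply: eq_bigr => i _ /=.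
by rewrite !mxE; ring.
Qed.

Lemma omega_alt v : omega v v = 0.
Proof. by rewrite /omega big1 // => i _; rewrite mulrC subrr. Qed.

Lemma omega_anti v w : omega v w = - omega w v.
Proof. by rewrite /omega -sumrN; apply: eq_bigr => i _; ring. Qed.

Lemma omega0r v : omega v 0 = 0.
Proof. by rewrite /omega big1 // => i _; rewrite !mxE; ring. Qed.

Lemma omegaE v w :
  omega v w = ((usubmx v)^T *m dsubmx w - (dsubmx v)^T *m usubmx w) 0 0.
Proof. by rewrite !mxE /omega sumrB; congr (_ - _); apply: eq_bigr => i _; rewrite !mxE. Qed.

Let tD (p q : nat) (A B : 'M[F]_(p, q)) : (A + B)^T = A^T + B^T.
Proof. exact: linearD. Qed.
Let tN (p q : nat) (A : 'M[F]_(p, q)) : (- A)^T = - A^T.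
Proof. exact: linearN. Qed.

Lemma omega_sp (X : 'M[F]_(n + n)) v w : X \in sp_space F n ->
  omega (X *m v) w = - omega v (X *m w).
Proof.
move=> /sp_spaceP[A [B [C [hB hC ->]]]].
rewrite -[v]vsubmxK -[w]vsubmxK; move: (usubmx v) (dsubmx v) (usubmx w) (dsubmx w).
move=> v1 v2 w1 w2; rewrite !mul_block_col !omegaE !col_mxKu !col_mxKd.
have E (P Q : 'M[F]_1) : P = - Q -> P 0 0 = - Q 0 0 by move=> ->; rewrite mxE.
apply: E.
rewrite ?(tD, tN, trmx_mul, trmxK) -hB -hC.
by rewrite !(mulmxDl, mulmxDr, mulNmx, mulmxN) !mulmxA; mxring.
Qed.

Fact heis_lieb_linearl (a : F) (x y z : heis) :
  heis_lieb (a *: x + y) z = a *: heis_lieb x z + heis_lieb y z.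
Proof.
by congr pair; rewrite /= ?omega_linearl // scaler0 addr0.
Qed.

Fact heis_lieb_linearr (a : F) (x y z : heis) :
  heis_lieb x (a *: y + z) = a *: heis_lieb x y + heis_lieb x z.
Proof.
by congr pair; rewrite /= ?omega_linearr // scaler0 addr0.
Qed.

Fact heis_lieb_alt (x : heis) : heis_lieb x x = 0.
Proof. by rewrite /heis_lieb omega_alt. Qed.

Fact heis_lieb_jacobi (x y z : heis) :
  heis_lieb x (heis_lieb y z) + heis_lieb y (heis_lieb z x)
  + heis_lieb z (heis_lieb x y) = 0.
Proof. by rewrite /heis_lieb /= !omega0r !addr0. Qed.

HB.instance Definition _ := Vector_isLieAlgebra.Build F heis
  heis_lieb_linearl heis_lieb_linearr heis_lieb_alt heis_lieb_jacobi.

Definition heis_z : heis := (0, 1).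

End Heisenberg.

Section SemidirectProduct.
Variables (F : fieldType) (n : nat).

(* (X, a) stands for X + a. *)
Definition gn := (sp F n * heis F n)%type.
HB.instance Definition _ := Vector.on gn.

Definition sp_heis (X : sp F n) (a : heis F n) : heis F n :=
  (vsval X *m a.1, 0).

Definition gn_lieb (x y : gn) : gn :=
  (lieb x.1 y.1, sp_heis x.1 y.2 - sp_heis y.1 x.2 + lieb x.2 y.2).

Fact gn_lieb_linearl (a : F) (x y z : gn) :
  gn_lieb (a *: x + y) z = a *: gn_lieb x z + gn_lieb y z.
Proof.
case: x y z => [X [v c]] [Y [w d]] [Z [u e]].
congr (_, (_, _)); rewrite /= ?lieb_linearl //.
  rewrite ?(mulmxDl, mulmxDr) -?scalemxAl -?scalemxAr.
  mxring.
by rewrite !subrr !add0r omega_linearl.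
Qed.

Fact gn_lieb_alt (x : gn) : gn_lieb x x = 0.
Proof. by rewrite /gn_lieb !lieb_alt subrr addr0. Qed.

Fact gn_lieb_linearr (a : F) (x y z : gn) :
  gn_lieb x (a *: y + z) = a *: gn_lieb x y + gn_lieb x z.
Proof.
case: x y z => [X [v c]] [Y [w d]] [Z [u e]].
congr (_, (_, _)); rewrite /= ?lieb_linearr //.
  rewrite ?(mulmxDl, mulmxDr) -?scalemxAl -?scalemxAr.
  mxring.
by rewrite !subrr !add0r omega_linearr.
Qed.

Fact gn_lieb_jacobi (x y z : gn) :
  gn_lieb x (gn_lieb y z) + gn_lieb y (gn_lieb z x) + gn_lieb z (gn_lieb x y)
  = 0.
Proof.
case: x y z => [X [v c]] [Y [w d]] [Z [u e]].
congr (_, (_, _)); rewrite /= ?lieb_jacobi //.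
  rewrite !addr0 !mulmxBr !mulmxBl !mulmxA; mxring.
have B (p q r : 'cV[F]_(n + n)) :
    omega p (q - r + 0) = omega p q - omega p r.
  by rewrite addr0 addrC -scaleN1r omega_linearr mulN1r addrC.
rewrite !B oppr0 !add0r.
have S (T : sp F n) p q : omega p (vsval T *m q) = omega q (vsval T *m p).
  by rewrite omega_anti omega_sp ?subvsP // opprK.
by rewrite (S Y v) (S Z v) (S X u); ring.
Qed.

HB.instance Definition _ := Vector_isLieAlgebra.Build F gn
  gn_lieb_linearl gn_lieb_linearr gn_lieb_alt gn_lieb_jacobi.

Definition sp_in (X : sp F n) : gn := (X, 0).
Definition heis_in (a : heis F n) : gn := (0, a).

Fact sp_in_linear : linear sp_in.
Proof. by move=> a X Y; congr pair; rewrite /= scaler0 addr0. Qed.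
HB.instance Definition _ := GRing.isLinear.Build F _ _ _ sp_in sp_in_linear.

Fact sp_in_lieb (X Y : sp F n) : sp_in (lieb X Y) = lieb (sp_in X) (sp_in Y).
Proof.
by congr (_, (_, _)); rewrite /= ?mulmx0 ?omega0r ?subrr ?addr0.
Qed.

Definition gn_z : gn := heis_in (heis_z F n).

Definition gn_cartan : {vspace gn} :=
  (linfun sp_in @: sp_cartan F n + <[gn_z]>)%VS.

Definition res_sp (M : lieModule gn) : lieModule (sp F n) :=
  restriction sp_in_lieb M.

End SemidirectProduct.

(* Main.v *)
From HB Require Import structures.
Require Import Defs.
From mathcomp Require Import all_boot all_order all_algebra.
From mathcomp Require Import ring complex.
From mathcomp Require Import boolp classical_sets reals.

Set Implicit Arguments.
Unset Strict Implicit.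
Unset Printing Implicit Defensive.

Import GRing.Theory Num.Theory.
Local Open Scope ring_scope.

(** Write [V] for the natural representation, [e_a] for its standard basis, [a']
    for the index paired with [a] by the symplectic form, and [s_ab] for the
    element [e_a . e_b] of the symplectic algebra, identified with the symmetric
    square of [V]. As [z] acts by zero, [V] acts by commuting operators, and
    [[s_ab, e_c] = omega(e_a, e_c) e_b + omega(e_b, e_c) e_a].

    The vectors on which [e_a] is nilpotent form a submodule, so each [e_a] acts
    on the simple module [M] either injectively or locally nilpotently
    (simple_injective_or_nilpotent). If all of them are locally nilpotent, they
    have a common kernel vector; the vectors killed by [V] form a submodule,
    which is therefore [M], and [V M = 0] (vec_act0). It remains to see that the
    set [I] of the indices with [e_a] injective is empty.

    The two uses of finite-dimensional weight spaces are these. First, [a] and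
    [a'] are not both in [I]: the operator [t = e_a e_a'] preserves weight
    spaces, [[s_aa, t]] is a nonzero multiple of [e_a ^ 2], and so a polynomial
    annihilating [t] on a weight space can be differentiated down to a nonzero
    constant (inj_idx_opp). Secondly, let [K] be the space of the vectors killed
    by the [e_b] with [b] outside [I]. If [i] is in [I] and [b] is not, [s_i'b]
    is locally nilpotent on the weight vectors [m] of [K]: otherwise the vectors
    [s_ib' ^ k s_i'b ^ k m] are infinitely many independent vectors of one weight
    space, being told apart by the powers of [e_b]
    (null_vector_s_nilpotent). As the [s_i'b] generate a nilpotent algebra
    acting on [K], some nonzero weight vector [q] of [K] is killed by all of them
    (lowest_vector_exists).

    Grade by the element of the Cartan subalgebra with eigenvalue [1] on [e_i]
    for [i] in [I], [-1] on [e_i'], and [0] on the other [e_b]. Everything of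
    negative degree kills [q], what has degree [0] preserves the space of such
    vectors, and so does [e_i], which raises the degree. For [i] in [I] the
    nonzero vector [e_i q] thus generates a submodule living in degrees greater
    than that of [q] (raised_submodule, raised_level). It does not contain [q],
    which contradicts simplicity (inj_idx_false).

    Finally, a weight of the Cartan subalgebra of [g_n] with a nonzero weight
    vector vanishes on [z], so the weight decompositions over [g_n] and over the
    symplectic algebra are the same (harish_chandra_res). *)

(** * Iterates and polynomials of linear operators *)

Section IteratedOperators.
Variables (F : fieldType) (V : lmodType F).
Implicit Types (S T P : {linear V -> V}) (p : {poly F}) (m : V).

Lemma iter_linear0 T k : iter k T 0 = 0.
Proof. by elim: k => //= k ->; rewrite linear0. Qed.

Lemma iter_linearP T k a u v :
  iter k T (a *: u + v) = a *: iter k T u + iter k T v.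
Proof. by elim: k => //= k ->; rewrite linearP. Qed.

Lemma iter_linearD T k u v : iter k T (u + v) = iter k T u + iter k T v.
Proof. by elim: k => //= k ->; rewrite linearD. Qed.

Lemma iter_linearZ T k a u : iter k T (a *: u) = a *: iter k T u.
Proof. by elim: k => //= k ->; rewrite linearZ. Qed.

Lemma iter_linear_sum T k (I : Type) (r : seq I) (P : pred I) (f : I -> V) :
  iter k T (\sum_(i <- r | P i) f i) = \sum_(i <- r | P i) iter k T (f i).
Proof. by elim: k => //= k ->; rewrite linear_sum. Qed.

Lemma iter_comm T (S : V -> V) k m :
  (forall u, T (S u) = S (T u)) -> iter k T (S m) = S (iter k T m).
Proof. by move=> TS; elim: k => //= k ->; rewrite TS. Qed.

Lemma iter_le0 T j k m : (j <= k)%N -> iter j T m = 0 -> iter k T m = 0.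
Proof. by move=> /subnK <- h; rewrite iterD h iter_linear0. Qed.

(** Powers of [T] behave under [S] as under a derivation, because the
    commutator [P] of [S] and [T] commutes with [T]. *)
Lemma iter_commutator S T P k m :
    (forall u, S (T u) = T (S u) + P u) ->
    (forall u, T (P u) = P (T u)) ->
  S (iter k T m) = iter k T (S m) + k%:R *: P (iter k.-1 T m).
Proof.
move=> ST TP; elim: k => [|k IH]; first by rewrite scale0r addr0.
rewrite !iterS ST IH linearD linearZ /= TP -addrA; congr (_ + _).
case: k {IH} => [|k]; first by rewrite scale0r add0r scale1r.
by rewrite /= [k.+2%:R]mulrS scalerDl scale1r addrC.
Qed.

Definition poly_op T (p : {poly F}) m := \sum_(i < size p) p`_i *: iter i T m.

Lemma poly_op_wide T p N m : (size p <= N)%N ->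
  poly_op T p m = \sum_(i < N) p`_i *: iter i T m.
Proof.
move=> le_pN; rewrite /poly_op.
rewrite (big_ord_widen N (fun i => p`_i *: iter i T m)) // big_mkcond.
apply: eq_bigr => i _; case: ltnP => // le_pi.
by rewrite nth_default ?scale0r.
Qed.

Lemma poly_op_comm T (S : {linear V -> V}) p m :
  (forall u, T (S u) = S (T u)) -> poly_op T p (S m) = S (poly_op T p m).
Proof.
move=> TS; rewrite /poly_op linear_sum; apply: eq_bigr => i _.
by rewrite iter_comm // linearZ.
Qed.

(** [[S, p(T)] = P p'(T)]. *)
Lemma poly_op_commutator S T P p m :
    (forall u, S (T u) = T (S u) + P u) ->
    (forall u, T (P u) = P (T u)) ->
  S (poly_op T p m) = poly_op T p (S m) + P (poly_op T p^`() m).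
Proof.
move=> ST TP; rewrite /poly_op linear_sum /=.
under eq_bigr => i _ do
  rewrite linearZ /= (iter_commutator _ _ ST TP) scalerDr.
rewrite big_split /=; congr (_ + _).
rewrite -/(poly_op T p^`() m) (@poly_op_wide _ _ (size p).-1); last first.
  by have [->|nz] := eqVneq p 0; rewrite ?deriv0 ?size_poly0 // -ltnS prednK
    ?size_poly_gt0 // lt_size_deriv.
case: (size p) => [|N] /=; first by rewrite !big_ord0 linear0.
rewrite big_ord_recl /= scale0r scaler0 add0r linear_sum.
apply: eq_bigr => i _; rewrite coef_deriv scalerA.
by rewrite linearZ /= add0n mulr_natr.
Qed.

End IteratedOperators.

(** * Operators on finite-dimensional subspaces *)

Section FiniteDimensional.
Variables (F : fieldType) (L : lieAlgType F) (M : lieModule L) (E : set M).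
Hypothesis fdE : finite_dim E.

(** Vectors [w a] with [T ^ a (w a) <> 0 = T ^ (a + 1) (w a)] would be
    independent: in a linear relation, [T ^ a] isolates the term of the largest
    index [a]. *)
Lemma finite_dim_nilpotency_bounded (T : {linear M -> M}) (w : nat -> M) :
    (forall a, E (w a)) -> (forall a, iter a.+1 T (w a) = 0) ->
  exists a, iter a T (w a) = 0.
Proof.
move=> Ew Tw; apply: contrapT => /forallNP nzTw.
have [s sE] := fdE.
have /choice[c cE] : forall a, exists c : 'I_(size s) -> F,
    w a = \sum_(i < size s) c i *: s`_i by move=> a; apply/sE.
pose C : 'M[F]_((size s).+1, size s) := \matrix_(a, i) c a i.
have /rowV0Pn[u /sub_kermxP uC nz_u] : kermx C != 0.
  by rewrite kermx_eq0 -row_leq_rank -ltnNge ltnS rank_leq_col.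
have dep : \sum_a u 0 a *: w a = 0.
  under eq_bigr => a _ do rewrite cE scaler_sumr.
  rewrite exchange_big /= big1 // => i _.
  under eq_bigr => a _ do rewrite scalerA.
  rewrite -scaler_suml.
  by move/rowP: uC => /(_ i); rewrite !mxE; under eq_bigr do rewrite mxE;
    move=> ->; rewrite scale0r.
have /existsP[a0 a0P] : [exists a, u 0 a != 0].
  apply: contraNT nz_u => /existsPn u0; apply/eqP/rowP => a.
  by rewrite mxE; apply/eqP/negbNE/u0.
case: (@arg_maxnP _ a0 (fun a => u 0 a != 0) val a0P) => a nz_ua a_max.
have /(congr1 (iter a T)) := dep.
rewrite iter_linear0 iter_linear_sum (bigD1 a) //= big1 ?addr0; last first.
  move=> b ne_ba; rewrite iter_linearZ.
  have [lt_ab|lt_ba|eq_ab] := ltngtP a b.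
  - have [->|/a_max] := eqVneq (u 0 b) 0; first by rewrite scale0r.
    by rewrite /= leqNgt lt_ab.
  - by rewrite (iter_le0 lt_ba (Tw b)) scaler0.
  - by rewrite (val_inj eq_ab) eqxx in ne_ba.
rewrite iter_linearZ => /eqP; rewrite scaler_eq0 (negPf nz_ua) /= => /eqP.
exact: nzTw.
Qed.

(** The polynomial is the characteristic polynomial of a matrix expressing [T]
    on a spanning family; as Cayley-Hamilton is about matrices, linear relations
    in the family do no harm. *)
Lemma finite_dim_annihilator (T : {linear M -> M}) :
    (forall m, E m -> E (T m)) ->
  exists2 p : {poly F}, p != 0 & forall m, E m -> poly_op T p m = 0.
Proof.
move=> TE; have [s sE] := fdE.
case s_eq : (size s) => [|N].
  exists 1; rewrite ?oner_eq0 // => m /sE[c ->].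
  rewrite /poly_op big1 // => i _; rewrite big1 ?iter_linear0 ?scaler0 //.
  by case=> j lt_j; exfalso; rewrite s_eq in lt_j.
have sE' m : E m <-> exists c : 'I_N.+1 -> F, m = \sum_(i < N.+1) c i *: s`_i.
  by rewrite -s_eq; apply: sE.
have Es (i : 'I_N.+1) : E s`_i.
  apply/sE'; exists (fun j => (j == i)%:R); rewrite (bigD1 i) //= eqxx scale1r.
  by rewrite big1 ?addr0 // => j /negPf ->; rewrite scale0r.
have /choice[c cE] (i : 'I_N.+1) : exists c : 'I_N.+1 -> F,
    T s`_i = \sum_(j < N.+1) c j *: s`_j by apply/sE'/TE/Es.
pose A : 'M[F]_N.+1 := \matrix_(i, j) c i j.
have TA k (i : 'I_N.+1) : iter k T s`_i = \sum_j (A ^+ k) i j *: s`_j.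
  elim: k i => [|k IH] i.
    rewrite expr0 (bigD1 i) //= mxE eqxx scale1r big1 ?addr0 // => j ne_ji.
    by rewrite mxE eq_sym (negPf ne_ji) scale0r.
  rewrite iterSr cE iter_linear_sum.
  under eq_bigr => l _ do rewrite iter_linearZ IH scaler_sumr.
  rewrite exchange_big /=; apply: eq_bigr => j _; rewrite exprS mxE.
  rewrite scaler_suml; apply: eq_bigr => l _.
  by rewrite scalerA mxE.
exists (char_poly A); first exact/monic_neq0/char_poly_monic.
have ps (i : 'I_N.+1) : poly_op T (char_poly A) s`_i = 0.
  rewrite /poly_op; under eq_bigr => k _ do rewrite TA scaler_sumr.
  rewrite exchange_big /= big1 // => j _.
  under eq_bigr => k _ do rewrite scalerA.
  rewrite -scaler_suml; move/matrixP: (Cayley_Hamilton A) => /(_ i j).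
  rewrite /horner_mx /= /horner_morph horner_coef mxE.
  rewrite size_map_inj_poly ?rmorph0 //; last exact: fmorph_inj.
  rewrite summxE => CH; rewrite [X in X *: _](_ : _ = 0) ?scale0r //.
  apply: etrans CH; apply: eq_bigr => k _.
  by rewrite coef_map /= -mulmxE mul_scalar_mx mxE.
move=> m /sE'[d ->]; rewrite /poly_op.
under eq_bigr => k _ do rewrite iter_linear_sum scaler_sumr.
rewrite exchange_big /= big1 // => i _.
transitivity (d i *: poly_op T (char_poly A) s`_i); last first.
  by rewrite ps scaler0.
rewrite /poly_op scaler_sumr.
by apply: eq_bigr => k _; rewrite iter_linearZ !scalerA mulrC.
Qed.

End FiniteDimensional.

(** * The symplectic algebra as a symmetric square *)

Section SymmetricSquare.
Variables (F : fieldType) (n : nat).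
Implicit Types (u v w : 'cV[F]_(n + n)) (X Y : sp F n).

(** The linear form [omega u] as a row vector. *)
Definition omega_row u : 'rV[F]_(n + n) :=
  row_mx (- (dsubmx u)^T) (usubmx u)^T.

Lemma mul_omega_row u v : omega_row u *m v = (omega u v)%:M.
Proof.
rewrite [RHS]mx11_scalar mxE mulr1n omegaE -mx11_scalar.
by rewrite -{1}[v]vsubmxK mul_row_col mulNmx addrC.
Qed.

Definition sym2_mx u w := w *m omega_row u + u *m omega_row w.

Fact sym2_subproof u w : sym2_mx u w \in sp_space F n.
Proof.
rewrite /sym2_mx /omega_row -[u]vsubmxK -[w]vsubmxK !col_mxKu !col_mxKd.
move: (usubmx u) (dsubmx u) (usubmx w) (dsubmx w) => u1 u2 w1 w2.
rewrite !mul_col_row add_block_mx.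
apply/sp_spaceP.
exists (w1 *m - u2^T + u1 *m - w2^T), (w1 *m u1^T + u1 *m w1^T),
  (w2 *m - u2^T + u2 *m - w2^T); split=> //.
- by rewrite [RHS]linearD /= !trmx_mul !trmxK addrC.
- rewrite [RHS]linearD /= !mulmxN ![(- _)^T]linearN /=.
  by rewrite !trmx_mul !trmxK addrC.
- congr block_mx; rewrite linearD /= !mulmxN ![(- _)^T]linearN /=.
  by rewrite !trmx_mul !trmxK -opprD opprK addrC.
Qed.

(** The bilinear map that identifies the symmetric square of the natural
    representation with the symplectic Lie algebra. *)
Definition sym2 u w : sp F n := Subvs (sym2_subproof u w).

Lemma sym2E u w v :
  vsval (sym2 u w) *m v = omega u v *: w + omega w v *: u.
Proof.
by rewrite /= mulmxDl -!mulmxA !mul_omega_row !mul_mx_scalar.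
Qed.

Lemma sp_ext X Y : (forall v, vsval X *m v = vsval Y *m v) -> X = Y.
Proof.
move=> eqXY; apply/subvs_inj/matrixP => i j.
by have /matrixP/(_ i 0) := eqXY (delta_mx j 0); rewrite -!colE !mxE.
Qed.

Lemma sp_mulDl (a : F) X Y v :
  vsval (a *: X + Y) *m v = a *: (vsval X *m v) + vsval Y *m v.
Proof. by rewrite linearP mulmxDl scalemxAl. Qed.

Lemma sym2C u w : sym2 u w = sym2 w u.
Proof. by apply: sp_ext => v; rewrite !sym2E addrC. Qed.

Lemma sym2_linearl (a : F) u v w :
  sym2 (a *: u + v) w = a *: sym2 u w + sym2 v w.
Proof.
apply: sp_ext => x; rewrite sp_mulDl !sym2E omega_linearl scalerDl !scalerDr.
by rewrite !scalerA [omega w x * a]mulrC addrACA.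
Qed.

Lemma sym20l w : sym2 0 w = 0.
Proof.
by have := sym2_linearl (-1) w w w; rewrite scaleN1r addNr scaleN1r addNr.
Qed.

Lemma sym2Zl (a : F) u w : sym2 (a *: u) w = a *: sym2 u w.
Proof. by rewrite -[a *: u]addr0 sym2_linearl sym20l addr0. Qed.

Lemma lieb_sym2 X u w :
  lieb X (sym2 u w) = sym2 (vsval X *m u) w + sym2 u (vsval X *m w).
Proof.
apply: sp_ext => v; rewrite -[X in vsval (X + _)]scale1r sp_mulDl scale1r.
have -> : vsval (lieb X (sym2 u w)) *m v =
    vsval X *m (vsval (sym2 u w) *m v) - vsval (sym2 u w) *m (vsval X *m v).
  by rewrite !mulmxA -mulmxBl.
rewrite !sym2E mulmxDr -!scalemxAr !omega_sp ?subvsP // !scaleNr opprD.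
by rewrite addrACA [RHS]addrACA [X in X + _]addrC.
Qed.

Definition ev (a : 'I_(n + n)) : 'cV[F]_(n + n) := delta_mx a 0.

Definition opp_idx (a : 'I_(n + n)) : 'I_(n + n) :=
  match split a with inl i => rshift n i | inr i => lshift n i end.

Definition sgn_idx (a : 'I_(n + n)) : F :=
  match split a with inl _ => 1 | inr _ => -1 end.

Lemma opp_idx_lshift i : opp_idx (lshift n i) = rshift n i.
Proof. by rewrite /opp_idx (unsplitK (inl i)). Qed.

Lemma opp_idx_rshift i : opp_idx (rshift n i) = lshift n i.
Proof. by rewrite /opp_idx (unsplitK (inr i)). Qed.

Lemma opp_idxK : involutive opp_idx.
Proof.
by move=> a; case: (split_ordP a) => i ->;
  rewrite ?(opp_idx_lshift, opp_idx_rshift).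
Qed.

Lemma sgn_idx_opp a : sgn_idx (opp_idx a) = - sgn_idx a.
Proof.
by case: (split_ordP a) => i ->; rewrite ?(opp_idx_lshift, opp_idx_rshift)
  /sgn_idx (unsplitK (inl i)) (unsplitK (inr i)) ?opprK.
Qed.

Lemma opp_idx_neq a : opp_idx a != a.
Proof.
by case: (split_ordP a) => i ->;
  rewrite ?(opp_idx_lshift, opp_idx_rshift) ?eq_lrshift ?eq_rlshift.
Qed.

Lemma opp_idx_eq a b : (opp_idx a == b) = (a == opp_idx b).
Proof. exact: can2_eq opp_idxK opp_idxK _ _. Qed.

Lemma sgn_idx_neq0 a : sgn_idx a != 0.
Proof. by rewrite /sgn_idx; case: split; rewrite ?oppr_eq0 oner_eq0. Qed.

Lemma omega_evl a v : omega (ev a) v = sgn_idx a * v (opp_idx a) 0.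
Proof.
rewrite /omega /sgn_idx /opp_idx; case: (split_ordP a) => i ->.
  rewrite mul1r (bigD1 i) //= big1 ?addr0 => [|j ne_ji]; rewrite !mxE.
    by rewrite !eqxx eq_rlshift mul1r mul0r subr0.
  by rewrite eq_lshift eq_rlshift (negPf ne_ji) !mul0r subr0.
rewrite mulN1r (bigD1 i) //= big1 ?addr0 => [|j ne_ji]; rewrite !mxE.
  by rewrite !eqxx eq_lrshift mul1r mul0r sub0r.
by rewrite eq_rshift eq_lrshift (negPf ne_ji) !mul0r subr0.
Qed.

Lemma omega_ev a b : omega (ev a) (ev b) = sgn_idx a * (b == opp_idx a)%:R.
Proof. by rewrite omega_evl mxE eqxx andbT eq_sym. Qed.

Lemma omega_ev_eq0 a b : (omega (ev a) (ev b) == 0) = (b != opp_idx a).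
Proof.
rewrite omega_ev mulf_eq0 (negPf (sgn_idx_neq0 a)).
by case: (b == _); rewrite ?oner_eq0 ?eqxx.
Qed.

(** The weight of [ev a]; that of [sym2 (ev a) (ev b)] is [wt a + wt b]. *)
Definition wt (a : 'I_(n + n)) (i : 'I_n) : F :=
  (a == lshift n i)%:R - (a == rshift n i)%:R.

Lemma sp_h_ev i a : vsval (sp_h F i) *m ev a = wt a i *: ev a.
Proof.
rewrite /= /ev mulmxBl !mul_delta_mx_cond /wt.
rewrite [_ == a]eq_sym [rshift n i == a]eq_sym.
have [->|_] := eqVneq a (lshift n i).
  by rewrite eq_lrshift mulr1n mulr0n !subr0 scale1r.
have [->|_] := eqVneq a (rshift n i).
  by rewrite mulr1n mulr0n !sub0r scaleN1r.
by rewrite !mulr0n !subrr scale0r.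
Qed.

Lemma lieb_sp_h_sym2 i a b :
  lieb (sp_h F i) (sym2 (ev a) (ev b)) =
  (wt a i + wt b i) *: sym2 (ev a) (ev b).
Proof.
rewrite lieb_sym2 !sp_h_ev sym2Zl [X in _ + X]sym2C sym2Zl sym2C.
by rewrite -scalerDl.
Qed.

Lemma wt_opp a i : wt (opp_idx a) i = - wt a i.
Proof.
by rewrite /wt !opp_idx_eq opp_idx_lshift opp_idx_rshift opprB.
Qed.

(** [X] is half the sum of the [X e_a . e_a^*], with [e_a^*] the basis dual to
    [e_a] for the form [omega]. *)
Lemma sp_span (P : sp F n -> Prop) : 2%:R != 0 :> F ->
    P 0 -> (forall (a : F) X Y, P X -> P Y -> P (a *: X + Y)) ->
    (forall a b, P (sym2 (ev a) (ev b))) ->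
  forall X, P X.
Proof.
move=> nz2 P0 PD Ps X.
have PZ (a : F) Y : P Y -> P (a *: Y).
  by move=> PY; rewrite -[_ *: _]addr0; apply: PD.
have Psum (I : finType) (c : I -> F) (f : I -> sp F n) :
    (forall i, P (f i)) -> P (\sum_i c i *: f i).
  move=> Pf; elim/big_rec: _ => // i Y _ PY; exact: PD.
pose Y := \sum_a sgn_idx (opp_idx a) *: \sum_b vsval X b a *:
   sym2 (ev b) (ev (opp_idx a)).
suff -> : X = 2%:R^-1 *: Y by apply/PZ/Psum => a; apply: Psum.
apply: (scalerI nz2); rewrite scalerA divff // scale1r.
apply: sp_ext => v.
have sumE (I : finType) (c : I -> F) (f : I -> sp F n) :
    vsval (\sum_i c i *: f i) *m v = \sum_i c i *: (vsval (f i) *m v).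
  rewrite linear_sum mulmx_suml; apply: eq_bigr => i _.
  by rewrite linearZ /= scalemxAl.
rewrite linearZ /= -scalemxAl sumE.
have evE (x : 'cV[F]_(n + n)) : x = \sum_b x b 0 *: ev b.
  rewrite {1}[x]matrix_sum_delta; apply: eq_bigr => b _.
  by rewrite big_ord1.
have colX a : vsval X *m ev a = \sum_b vsval X b a *: ev b.
  by rewrite [LHS]evE; apply: eq_bigr => b _; rewrite -colE mxE.
have sgn2 a : sgn_idx a * sgn_idx a = 1.
  by rewrite /sgn_idx; case: split => _; rewrite ?mulrNN mulr1.
have omegaX a : \sum_b vsval X b a * omega (ev b) v =
    - sgn_idx a * (vsval X *m v) (opp_idx a) 0.
  transitivity (omega (vsval X *m ev a) v).
    rewrite colX; elim/big_rec2: _ => [|b x y _ ->].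
      by rewrite omega_anti omega0r oppr0.
    by rewrite omega_linearl.
  by rewrite omega_sp ?subvsP // omega_evl mulNr.
transitivity (\sum_a ((vsval X *m v) (opp_idx a) 0 *: ev (opp_idx a)
                      + v a 0 *: (vsval X *m ev a))).
  rewrite big_split /= scaler_nat mulr2n; congr (_ + _).
    rewrite {1}[vsval X *m v]evE (reindex_inj (can_inj opp_idxK)).
    exact: eq_bigr.
  rewrite {1}[v]evE mulmx_sumr; apply: eq_bigr => a _.
  by rewrite scalemxAr.
apply: eq_bigr => a _; rewrite sumE scaler_sumr.
under eq_bigr => b _ do rewrite sym2E !scalerDr !scalerA.
rewrite big_split /=; congr (_ + _).
  rewrite -scaler_suml; congr (_ *: _).
  under eq_bigr => b _ do rewrite -mulrA.
  by rewrite -mulr_sumr omegaX sgn_idx_opp mulrA mulrNN sgn2 mul1r.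
rewrite colX scaler_sumr; apply: eq_bigr => b _; rewrite scalerA.
congr (_ *: _); rewrite omega_evl opp_idxK.
by rewrite mulrAC mulrA sgn2 mul1r.
Qed.

End SymmetricSquare.

(** * Locally nilpotent elements of Lie algebras *)

Section LieModuleTheory.
Variables (F : fieldType) (L : lieAlgType F) (M : lieModule L).

Lemma lieb0l (x : L) : lieb 0 x = 0.
Proof.
have := lieb_linearl (1 : F) 0 0 x.
by rewrite scaler0 addr0 scale1r -{1}[lieb 0 x]addr0 => /addrI.
Qed.

Lemma lieb0r (x : L) : lieb x 0 = 0.
Proof.
have := lieb_linearr (1 : F) x 0 0.
by rewrite scaler0 addr0 scale1r -{1}[lieb x 0]addr0 => /addrI.
Qed.

HB.instance Definition _ (x : L) :=
  GRing.isLinear.Build F M M _ (act x) (fun a m m' => act_linearr a x m m').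

Lemma act_swap (x y : L) (m : M) :
  act x (act y m) = act y (act x m) + act (lieb x y) m.
Proof. by rewrite act_lieb addrC subrK. Qed.

Lemma act0l (m : M) : act 0 m = 0.
Proof.
by have := act_linearl (-1) 0 0 m; rewrite scaleN1r addNr scaleN1r addNr.
Qed.

Lemma actZl (a : F) (x : L) (m : M) : act (a *: x) m = a *: act x m.
Proof. by rewrite -[a *: x]addr0 act_linearl act0l addr0. Qed.

Lemma actDl (x y : L) (m : M) : act (x + y) m = act x m + act y m.
Proof. by rewrite -[x]scale1r act_linearl !scale1r. Qed.

Lemma act_suml (I : Type) (r : seq I) (f : I -> L) (m : M) :
  act (\sum_(i <- r) f i) m = \sum_(i <- r) act (f i) m.
Proof.
by elim: r => [|i r IH]; rewrite ?big_nil ?act0l // !big_cons actDl IH.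
Qed.

(** Kill the operators one after the other: the last nonzero iterate of each on
    a vector killed by the previous ones is still killed by them. The
    stable set [P] makes this applicable to operators that are nilpotent and
    commute only after restriction. *)
Lemma common_kernel (P : set M) (I : eqType) (s : seq I) (x : I -> L) :
    (exists2 u, u != 0 & P u) ->
    (forall i u, i \in s -> P u -> P (act (x i) u)) ->
    (forall i u, i \in s -> P u -> exists k, iter k (act (x i)) u = 0) ->
    (forall i j u, i \in s -> j \in s -> P u ->
       act (x i) (act (x j) u) = act (x j) (act (x i) u)) ->
  exists u, [/\ u != 0, P u & forall i, i \in s -> act (x i) u = 0].
Proof.
elim: s => [|i s IH] exP stP nilP comP; first by case: exP => u; exists u.
have [|||u [nzu Pu su]] := IH exP.
- by move=> j u js; apply: stP; rewrite inE js orbT.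
- by move=> j u js; apply: nilP; rewrite inE js orbT.
- by move=> j k u js ks; apply: comP; rewrite inE ?js ?ks orbT.
have si : i \in i :: s by rewrite mem_head.
have ss j : j \in s -> j \in i :: s by rewrite inE orbC => ->.
have inv k : P (iter k (act (x i)) u) /\
    forall j, j \in s -> act (x j) (iter k (act (x i)) u) = 0.
  elim: k => //= k [Pk sk]; split=> [|j js]; first exact: stP.
  by rewrite (comP j i _ (ss _ js) si Pk) (sk _ js) linear0.
have ex0 : exists k, iter k (act (x i)) u == 0.
  by have [k /eqP] := nilP i u si Pu; exists k.
have [k k0 kmin] := ex_minnP ex0.
case: k k0 kmin => [/=|k /= k0 kmin]; first by rewrite (negPf nzu).
have [Pk sk] := inv k; exists (iter k (act (x i)) u); split=> //.
  by apply/negP => /kmin; rewrite ltnn.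
by move=> j; rewrite inE => /predU1P[->|/sk //]; apply/eqP.
Qed.

(** As [x] commutes with [[x, y]], [x ^ k m = 0] entails
    [x ^ (k + 1) (y m) = 0]. *)
Lemma nilpotent_submodule (x : L) :
    (forall y (m : M), act x (act (lieb x y) m) = act (lieb x y) (act x m)) ->
  submodule [set m : M | exists k, iter k (act x) m = 0]%classic.
Proof.
move=> comm; split=> [|a u v [k ku] [l lv]|y m [k km]].
- by exists 0.
- exists (maxn k l); rewrite iter_linearP.
  rewrite (iter_le0 (leq_maxl k l) ku) (iter_le0 (leq_maxr k l) lv).
  by rewrite scaler0 addr0.
exists k.+1; elim: k m km => [m /= ->|k IH m]; first by rewrite !linear0.
rewrite iterSr => km; rewrite iterSr act_swap iter_linearD IH // add0r.
have -> : iter k.+1 (act x) (act (lieb x y) m) =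
          act (lieb x y) (iter k.+1 (act x) m).
  by apply: iter_comm => u; exact: comm.
by rewrite iterSr km linear0.
Qed.

Lemma simple_injective_or_nilpotent (x : L) :
    simple_module M ->
    (forall y (m : M), act x (act (lieb x y) m) = act (lieb x y) (act x m)) ->
  (forall m : M, act x m = 0 -> m = 0) \/
  (forall m : M, exists k, iter k (act x) m = 0).
Proof.
move=> [_ simM] comm.
case: (simM _ (nilpotent_submodule comm)) => nil; [left=> m xm0|right=> m].
  suff : [set m : M | exists k, iter k (act x) m = 0]%classic m by rewrite nil.
  by exists 1.
suff : [set m : M | exists k, iter k (act x) m = 0]%classic m by [].
by rewrite nil.
Qed.

End LieModuleTheory.

(** * Modules on which the center acts trivially *)

Section TrivialCentralCharge.
Variables (F : numFieldType) (n : nat) (M : lieModule (gn F n)).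
Hypothesis z_act0 : forall m : M, act (gn_z F n) m = 0.
Implicit Types (u v w : 'cV[F]_(n + n)) (X Y : sp F n) (m : M).
Implicit Types (a b c d i j : 'I_(n + n)).

Definition vec u : gn F n := heis_in (u, 0).

Lemma vec_linear (k : F) u v : vec (k *: u + v) = k *: vec u + vec v.
Proof. by congr (_, (_, _)); rewrite /= ?scaler0 addr0. Qed.

Lemma vecZ (k : F) u : vec (k *: u) = k *: vec u.
Proof. by congr (_, (_, _)); rewrite /= ?scaler0. Qed.

Lemma vecD u v : vec (u + v) = vec u + vec v.
Proof. by rewrite -[u]scale1r vec_linear !scale1r. Qed.

Lemma lieb_vec u v : lieb (vec u) (vec v) = omega u v *: gn_z F n.
Proof.
congr (_, (_, _)) => /=; first by rewrite lieb0l scaler0.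
  by rewrite !mul0mx subrr addr0 scaler0.
by rewrite subrr add0r [RHS]mulr1.
Qed.

Lemma omega0l v : omega 0 v = 0.
Proof. by rewrite omega_anti omega0r oppr0. Qed.

Lemma lieb_sp_vec X v : lieb (sp_in X) (vec v) = vec (vsval X *m v).
Proof.
congr (_, (_, _)) => /=; first exact: lieb0r.
  by rewrite mulmx0 subr0 addr0.
by rewrite subrr add0r omega0l.
Qed.

Lemma gn_decomp X v (k : F) :
  (X, (v, k)) = sp_in X + (vec v + k *: gn_z F n) :> gn F n.
Proof.
congr (_, (_, _)) => /=; first by rewrite scaler0 !addr0.
  by rewrite scaler0 addr0 add0r.
by rewrite !add0r [RHS]mulr1.
Qed.

Lemma lieb_vecE v X w (k : F) :
  lieb (vec v) (X, (w, k)) = vec (- (vsval X *m v)) + omega v w *: gn_z F n.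
Proof.
congr (_, (_, _)) => /=; first by rewrite lieb0l scaler0 addr0.
  by rewrite mul0mx sub0r !addr0 scaler0 addr0.
by rewrite subrr !add0r [RHS]mulr1.
Qed.

Lemma act_vec_comm u v m :
  act (vec u) (act (vec v) m) = act (vec v) (act (vec u) m).
Proof. by rewrite act_swap lieb_vec actZl z_act0 scaler0 addr0. Qed.

Lemma act_sp_vec X v m :
  act (sp_in X) (act (vec v) m) =
  act (vec v) (act (sp_in X) m) + act (vec (vsval X *m v)) m.
Proof. by rewrite act_swap lieb_sp_vec. Qed.

Lemma gn_span (P : gn F n -> Prop) :
    P 0 -> (forall (k : F) x y, P x -> P y -> P (k *: x + y)) ->
    P (gn_z F n) -> (forall a, P (vec (ev F a))) ->
    (forall a b, P (sp_in (sym2 (ev F a) (ev F b)))) ->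
  forall x, P x.
Proof.
move=> P0 PD Pz Pv Ps [X [v k]].
rewrite gn_decomp -[sp_in X]scale1r addrC [vec v + _]addrC -addrA.
apply: (PD) => //; rewrite addrC; apply: (PD).
  apply: (@sp_span _ _ (fun Y => P (sp_in Y))) => //=; rewrite ?pnatr_eq0 //.
  by move=> l Y Z PY PZ'; rewrite linearP; apply: PD.
rewrite [v]matrix_sum_delta.
apply: (big_rec (fun w => P (vec w))) => [|a w _ Pw]; first exact: P0.
by rewrite big_ord1 vec_linear; exact: (PD _ _ _ (Pv a) Pw).
Qed.

Lemma act_vec_orbit_comm v y m :
  act (vec v) (act (lieb (vec v) y) m) = act (lieb (vec v) y) (act (vec v) m).
Proof.
case: y => X [w k]; rewrite lieb_vecE !actDl !actZl !z_act0 scaler0 !addr0.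
exact: act_vec_comm.
Qed.

End TrivialCentralCharge.

Section Operators.
Variables (F : numFieldType) (n : nat) (M : lieModule (gn F n)).

Definition eop (a : 'I_(n + n)) (m : M) : M := act (vec (ev F a)) m.
Definition sop (a b : 'I_(n + n)) (m : M) : M :=
  act (sp_in (sym2 (ev F a) (ev F b))) m.
Definition hop (i : 'I_n) (m : M) : M := act (sp_in (sp_h F i)) m.

HB.instance Definition _ a :=
  GRing.isLinear.Build F M M _ (eop a) (fun k m m' => act_linearr k _ m m').
HB.instance Definition _ a b :=
  GRing.isLinear.Build F M M _ (sop a b) (fun k m m' => act_linearr k _ m m').
HB.instance Definition _ i :=
  GRing.isLinear.Build F M M _ (hop i) (fun k m m' => act_linearr k _ m m').

Definition weight_vector (mu : 'I_n -> F) : set M :=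
  [set m | forall i, hop i m = mu i *: m]%classic.

End Operators.

(** * Injective and locally nilpotent basis vectors *)

Section SimpleModule.
Variables (F : numFieldType) (n : nat) (M : lieModule (gn F n)).
Hypothesis z_act0 : forall m : M, act (gn_z F n) m = 0.
Implicit Types (m : M) (a b c d f i j : 'I_(n + n)) (mu nu : 'I_n -> F).

Notation e := (@eop F n M).
Notation s := (@sop F n M).
Notation h := (@hop F n M).
Notation om a b := (omega (ev F a) (ev F b)).
Notation opp := (@opp_idx n).

Lemma e_comm a b m : e a (e b m) = e b (e a m).
Proof. exact: act_vec_comm. Qed.

Lemma s_e a b c m :
  s a b (e c m) = e c (s a b m) + (om a c *: e b m + om b c *: e a m).
Proof. by rewrite /sop /eop act_sp_vec sym2E vecD !vecZ actDl !actZl. Qed.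

Lemma s_sym a b m : s a b m = s b a m.
Proof. by rewrite /sop sym2C. Qed.

Lemma s_s a b c d m : s c d (s a b m) =
  s a b (s c d m) + (om c a *: s d b m + om d a *: s c b m
                     + (om c b *: s a d m + om d b *: s a c m)).
Proof.
have sL (k l : F) u v w (x : M) : act (sp_in (sym2 (k *: u + l *: v) w)) x =
    k *: act (sp_in (sym2 u w)) x + l *: act (sp_in (sym2 v w)) x.
  by rewrite sym2_linearl sym2Zl linearP act_linearl linearZ actZl.
rewrite [s a d m]s_sym [s a c m]s_sym /sop act_swap -sp_in_lieb lieb_sym2.
have -> X Y : sp_in (X + Y) = sp_in X + sp_in Y by exact: linearD.
rewrite actDl !sym2E [sym2 (ev F a) (_ + _)]sym2C.
rewrite (sL (om c a) (om d a) (ev F d) (ev F c)).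
by rewrite (sL (om c b) (om d b) (ev F d) (ev F c)).
Qed.

Lemma h_e (k : 'I_n) a m : h k (e a m) = e a (h k m) + wt F a k *: e a m.
Proof. by rewrite /hop /eop act_sp_vec sp_h_ev vecZ actZl. Qed.

Lemma h_s (k : 'I_n) a b m :
  h k (s a b m) = s a b (h k m) + (wt F a k + wt F b k) *: s a b m.
Proof.
rewrite /hop /sop act_swap -sp_in_lieb lieb_sp_h_sym2.
have -> r X : sp_in (r *: X) = r *: sp_in X by exact: linearZ.
by rewrite actZl.
Qed.

Lemma om_eq0 a b : b != opp a -> om a b = 0.
Proof. by move=> ne; apply/eqP; rewrite omega_ev_eq0. Qed.

Lemma om_neq0 a : om a (opp a) != 0.
Proof. by rewrite omega_ev_eq0 eqxx. Qed.

Lemma submodule_gen (U : set M) : U 0 ->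
    (forall (k : F) u v, U u -> U v -> U (k *: u + v)) ->
    (forall a u, U u -> U (e a u)) -> (forall a b u, U u -> U (s a b u)) ->
  submodule U.
Proof.
move=> U0 UD Ue Us; split=> // x u Uu; move: x.
apply: gn_span => [|k x y Ux Uy||a|a b].
- by rewrite act0l.
- by rewrite act_linearl; apply: UD.
- by rewrite z_act0.
- exact: Ue.
- exact: Us.
Qed.

Lemma weight_vector_ext mu nu m :
  mu =1 nu -> weight_vector mu m -> weight_vector nu m.
Proof. by move=> eq_mu mum i; rewrite -eq_mu. Qed.

Lemma weight_vector_e mu a m : weight_vector mu m ->
  weight_vector (fun r => mu r + wt F a r) (e a m).
Proof. by move=> mum i; rewrite h_e mum linearZ -scalerDl. Qed.

Lemma weight_vector_s mu a b m : weight_vector mu m ->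
  weight_vector (fun r => mu r + (wt F a r + wt F b r)) (s a b m).
Proof. by move=> mum i; rewrite h_s mum linearZ -scalerDl. Qed.

Lemma weight_vector_iter_s mu a b k m : weight_vector mu m ->
  weight_vector (fun r => mu r + k%:R * (wt F a r + wt F b r))
    (iter k (s a b) m).
Proof.
move=> mum; elim: k => [|k IH].
  by apply: (weight_vector_ext _ mum) => r; rewrite mul0r addr0.
apply: (weight_vector_ext _ (weight_vector_s a b IH)) => r.
by rewrite mulrSr mulrDl mul1r -addrA.
Qed.

(** [x], [y] and the central [p = [y, x]] span a Heisenberg algebra, in which [y]
    acts as [p] times the derivative in [x] on the vectors [x ^ a k0], because
    [y k0 = 0]. *)
Lemma ladder (y x p : {linear M -> M}) k0 (a : nat) :
    (forall m, y (x m) = x (y m) + p m) ->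
    (forall m, x (p m) = p (x m)) -> (forall m, y (p m) = p (y m)) ->
    y k0 = 0 ->
  iter a y (iter a x k0) = a`!%:R *: iter a p k0.
Proof.
move=> yx xp yp yk0; elim: a => [|a IH]; first by rewrite scale1r.
rewrite iterSr (iter_commutator a.+1 k0 yx xp) yk0 iter_linear0 add0r.
have -> : iter a y (a.+1%:R *: p (iter a x k0)) =
    a.+1%:R *: p (iter a y (iter a x k0)).
  by rewrite iter_linearZ (iter_comm _ _ yp).
by rewrite IH linearZ scalerA factS natrM.
Qed.

Hypothesis fd_weight : forall mu, finite_dim (@weight_vector F n M mu).
Hypothesis simM : simple_module M.

Definition inj_idx a : bool := `[< forall m, e a m = 0 -> m = 0 >].

Lemma inj_idxP a m : inj_idx a -> e a m = 0 -> m = 0.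
Proof. by move/asboolP; apply. Qed.

Lemma inj_idx_iter a k m : inj_idx a -> iter k (e a) m = 0 -> m = 0.
Proof. by move=> ia; elim: k => //= k IH /(inj_idxP ia)/IH. Qed.

Lemma noninj_nilpotent a m : ~~ inj_idx a -> exists k, iter k (e a) m = 0.
Proof.
move/asboolP => ninj.
have comm y m' : e a (act (lieb (vec (ev F a)) y) m') =
    act (lieb (vec (ev F a)) y) (e a m') by exact: act_vec_orbit_comm.
by case: (simple_injective_or_nilpotent simM comm) => [/ninj|/(_ m)].
Qed.

(** With [t = e_a e_a'], the commutator [[s_aa, t]] is a multiple of [e_a ^ 2].
    Hence the annihilating polynomials of [t] on a weight space are closed under
    derivation, and the weight space vanishes. *)
Lemma inj_idx_opp a : (exists mu, exists2 m : M, m != 0 & weight_vector mu m) ->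
  inj_idx a -> inj_idx (opp a) = false.
Proof.
case=> mu [m0 nz_m0 mum0] ia; apply/negP => ia'.
pose t : {linear M -> M} := e a \o e (opp a).
pose P : {linear M -> M} := ((om a (opp a) *+ 2) \*: (e a \o e a)).
have omaa : om a a = 0 by apply: om_eq0; rewrite eq_sym opp_idx_neq.
have tmu nu m : weight_vector nu m -> weight_vector nu (t m).
  move=> num; apply: (weight_vector_ext _ (weight_vector_e _
    (weight_vector_e _ num))) => r.
  by rewrite wt_opp subrK.
have st m : s a a (t m) = t (s a a m) + P m.
  rewrite /t /P /= s_e omaa !scale0r !addr0 s_e -scalerDl -mulr2n.
  by rewrite linearD linearZ.
have tP m : t (P m) = P (t m).
  by rewrite /t /P /= !linearZ /= ![e (opp a) (e a _)]e_comm.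
have null N (p : {poly F}) : (size p <= N)%N -> p != 0 ->
    ~ (forall m, weight_vector mu m -> poly_op t p m = 0).
  elim: N p => [|N IH] p.
    by rewrite leqn0 size_poly_eq0 => /eqP->; rewrite eqxx.
  move=> le_pN nzp pmu; have [p1|p_gt1] := leqP (size p) 1.
    have := pmu _ mum0; rewrite (size1_polyC p1) in nzp *.
    rewrite (poly_op_wide _ _ (size_polyC_leq1 _)) big_ord1 coefC /=.
    by move/eqP; rewrite scaler_eq0 (negPf nz_m0) orbF -polyC_eq0 (negPf nzp).
  have lt_p' : (size p^`() < size p)%N by apply: lt_size_deriv.
  apply: (IH p^`()) => [||m mum]; first by rewrite -ltnS (leq_trans lt_p').
    apply: contraTneq p_gt1 => p'0; rewrite -leqNgt.
    apply/leq_sizeP => -[|j] // _; have := coef_deriv p j.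
    by rewrite p'0 coef0 => /esym/eqP; rewrite mulrn_eq0 => /eqP.
  have p_s : poly_op t p (s a a m) = 0.
    pose q : {linear M -> M} := e (opp a) \o e (opp a).
    apply: (inj_idxP ia'); apply: (inj_idxP ia').
    rewrite -[LHS]/(q _) -(poly_op_comm (S := q)); last first.
      by move=> u; rewrite /t /q /= ![e a _]e_comm.
    apply: pmu; apply: (weight_vector_ext _ (weight_vector_e _
      (weight_vector_e _ (weight_vector_s a a mum)))) => r.
    by rewrite wt_opp; ring.
  have := poly_op_commutator p m st tP; rewrite pmu // linear0 p_s add0r /P /=.
  move/esym/eqP; rewrite scaler_eq0 mulrn_eq0 /= (negPf (om_neq0 a)) /=.
  by move/eqP => /(inj_idxP ia)/(inj_idxP ia).
have [p nzp pmu] := finite_dim_annihilator (fd_weight mu) (tmu mu).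
exact: (null _ p (leqnn _) nzp).
Qed.

(** * Vectors killed by the negative part *)

Hypothesis weightE : exists mu, exists2 m : M, m != 0 & weight_vector mu m.

Definition null_vector : set M :=
  [set m | forall f, ~~ inj_idx f -> e f m = 0]%classic.

Lemma null_vector_e a m : null_vector m -> null_vector (e a m).
Proof. by move=> mK f nf; rewrite e_comm mK // linear0. Qed.

Lemma null_vector_s a b m : ~~ inj_idx a -> ~~ inj_idx b ->
  null_vector m -> null_vector (s a b m).
Proof.
move=> na nb mK f nf; have := s_e a b f m.
by rewrite (mK f) // (mK a) // (mK b) // !scaler0 !addr0 linear0.
Qed.

(** Suppose that [m_k = s_i'b ^ k m] never vanishes. The vectors [s_ib' ^ k m_k]
    have the same weight as [m], and by the ladder identity [e_b ^ k] maps the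
    [k]-th one to a nonzero multiple of [e_i ^ k m_k], which [e_b] kills. *)
Lemma null_vector_s_nilpotent mu i b m : inj_idx i -> ~~ inj_idx b ->
    weight_vector mu m -> null_vector m ->
  exists k, iter k (s (opp i) b) m = 0.
Proof.
move=> ii nb mum mK.
have ni' : ~~ inj_idx (opp i) by rewrite inj_idx_opp.
have Kk k : null_vector (iter k (s (opp i) b) m).
  by elim: k => //= k IH; apply: null_vector_s.
have bi : i != b by apply: contraNneq nb => <-.
(* The scalar with [[e_b, s_ib'] = kappa e_i]; both terms of the bracket
   contribute if [b = i'], when [s_ib' = s_ii]. *)
pose kappa := - (om (opp b) b + (b == opp i)%:R * om i b).
have nz_kappa : kappa != 0.
  rewrite oppr_eq0; have [->|_] := eqVneq b (opp i).
    by rewrite opp_idxK mul1r -mulr2n mulrn_eq0 om_neq0.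
  by rewrite mul0r addr0 -{2}[b]opp_idxK om_neq0.
pose p : {linear M -> M} := kappa \*: e i.
have yx m' : e b (s i (opp b) m') = s i (opp b) (e b m') + p m'.
  rewrite s_e /p /= scaleNr scalerDl.
  have [->|ne] := eqVneq b (opp i).
    by rewrite opp_idxK mul1r [X in _ + X - _]addrC addrK.
  by rewrite (om_eq0 ne) mul0r !scale0r add0r addr0 addrK.
have xp m' : s i (opp b) (p m') = p (s i (opp b) m').
  rewrite /p /= linearZ /= s_e !om_eq0 ?opp_idxK ?scale0r ?addr0 //.
  by rewrite eq_sym opp_idx_neq.
have yp m' : e b (p m') = p (e b m') by rewrite /p /= linearZ /= e_comm.
have pE k m' : iter k p m' = kappa ^+ k *: iter k (e i) m'.
  elim: k => [|k IH]; first by rewrite scale1r.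
  by rewrite iterS IH /p /= linearZ scalerA exprSr mulrC.
pose w k := iter k (s i (opp b)) (iter k (s (opp i) b) m).
have yw k : iter k (e b) (w k) = k`!%:R *: iter k p (iter k (s (opp i) b) m).
  by apply: ladder yx xp yp _; apply: Kk.
have [k|k|k] := @finite_dim_nilpotency_bounded _ _ _ _ (fd_weight mu) (e b) w.
- rewrite /w; apply: (weight_vector_ext _ (weight_vector_iter_s i (opp b) k
    (weight_vector_iter_s (opp i) b k mum))) => r.
  by rewrite !wt_opp; ring.
- have -> : iter k.+1 (e b) (w k) = e b (iter k (e b) (w k)) by [].
  rewrite yw linearZ.
  transitivity (k`!%:R *: iter k p (e b (iter k (s (opp i) b) m))).
    by congr (_ *: _); apply/esym/iter_comm => u; rewrite yp.
  by rewrite (Kk k) // iter_linear0 scaler0.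
rewrite yw pE => /eqP; rewrite !scaler_eq0 expf_eq0 (negPf nz_kappa) andbF.
rewrite pnatr_eq0 -leqn0 leqNgt fact_gt0 /= => /eqP/(inj_idx_iter ii) h0.
by exists k.
Qed.

Definition lowest_vector : set M :=
  [set m | null_vector m /\
    forall i b, inj_idx i -> ~~ inj_idx b -> s (opp i) b m = 0]%classic.

(** The brackets of the operators [s (opp i) b] are combinations of the
    [s (opp i) (opp j)], which commute with all of them. Once these are killed,
    the others commute as well. *)
Lemma lowest_vector_exists :
  exists mu, exists2 m : M, m != 0 & weight_vector mu m /\ lowest_vector m.
Proof.
pose W : set M := [set m | exists mu, weight_vector mu m]%classic.
have injN i : inj_idx i -> inj_idx (opp i) = false := inj_idx_opp weightE.
have ne_inj i b : inj_idx i -> ~~ inj_idx b -> b != i.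
  by move=> ii nb; apply: contraNneq nb => ->.
have We a m : W m -> W (e a m).
  by case=> mu mum; eexists; apply: weight_vector_e.
have Ws a b m : W m -> W (s a b m).
  by case=> mu mum; eexists; apply: weight_vector_s.
have [||||m1 [nz1 W1 K1]] := @common_kernel _ _ M W _
    [seq a <- enum 'I_(n + n) | ~~ inj_idx a] (fun a => vec (ev F a)).
- by case: weightE => mu [m nzm mum]; exists m => //; exists mu.
- by move=> a u _; apply: We.
- move=> a u; rewrite mem_filter => /andP[na _] _.
  exact: noninj_nilpotent.
- by move=> a b u _ _ _; apply: e_comm.
pose WK : set M := [set m | W m /\ null_vector m]%classic.
have WK1 : WK m1.
  by split=> // f nf; apply: K1; rewrite mem_filter nf mem_enum.
have [||||m2 [nz2 WK2 C2]] := @common_kernel _ _ M WK _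
    [seq ij <- enum {: 'I_(n + n) * 'I_(n + n)} | inj_idx ij.1 && inj_idx ij.2]
    (fun ij => sp_in (sym2 (ev F (opp ij.1)) (ev F (opp ij.2)))).
- by exists m1.
- move=> [i j] u; rewrite mem_filter => /andP[/andP[/= ii ij] _] [Wu Ku].
  by split; [apply: Ws | apply: null_vector_s; rewrite ?injN].
- move=> [i j] u; rewrite mem_filter => /andP[/andP[/= ii ij] _] [[mu muu] Ku].
  by apply: null_vector_s_nilpotent muu Ku; rewrite ?injN.
- move=> [i j] [k l] u; rewrite !mem_filter.
  case/andP=> /andP[/= ii ij] _ /andP[/andP[/= ik il] _] _.
  apply: etrans (s_s _ _ _ _ _) _.
  by rewrite !om_eq0 ?opp_idxK ?ne_inj ?injN // !scale0r !addr0.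
pose WKC : set M := [set m | WK m /\
  forall i j, inj_idx i -> inj_idx j -> s (opp i) (opp j) m = 0]%classic.
have WKC2 : WKC m2.
  split=> // i j ii ij; apply: (C2 (i, j)).
  by rewrite mem_filter /= ii ij mem_enum.
have [||||m3 [nz3 WKC3 N3]] := @common_kernel _ _ M WKC _
    [seq ib <- enum {: 'I_(n + n) * 'I_(n + n)} |
       [&& inj_idx ib.1, ~~ inj_idx ib.2 & ~~ inj_idx (opp ib.2)]]
    (fun ib => sp_in (sym2 (ev F (opp ib.1)) (ev F ib.2))).
- by exists m2.
- move=> [i b] u; rewrite mem_filter => /andP[/and3P[/= ii nb nb'] _].
  case=> [[Wu Ku] Cu]; split; first split.
  + exact: Ws.
  + by apply: null_vector_s; rewrite ?injN.
  + move=> k l ik il; rewrite [LHS]s_s Cu // linear0.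
    by rewrite !om_eq0 ?opp_idxK ?ne_inj ?injN // !scale0r !addr0.
- move=> [i b] u; rewrite mem_filter => /andP[/and3P[/= ii nb nb'] _].
  case=> [[[mu muu] Ku] _].
  exact: null_vector_s_nilpotent muu Ku.
- move=> [i b] [k d] u; rewrite !mem_filter.
  case/andP=> /and3P[/= ii nb nb'] _ /andP[/and3P[/= ik nd nd'] _] [_ Cu].
  apply: etrans (s_s _ _ _ _ _) _; rewrite (Cu k i) // scaler0.
  rewrite !om_eq0 ?opp_idxK.
  + by rewrite !scale0r !addr0.
  + by rewrite ne_inj.
  + by rewrite (inj_eq (can_inj (@opp_idxK n))) eq_sym ne_inj.
  + by rewrite ne_inj ?injN.
case: WKC3 => [[[mu mum] Km] Cm]; exists mu, m3 => //; split=> //.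
split=> // i b ii nb; have [ib'|nb'] := boolP (inj_idx (opp b)).
  by rewrite -[b]opp_idxK Cm.
by apply: (N3 (i, b)); rewrite mem_filter /= ii nb nb' mem_enum.
Qed.

(** * The grading and the contradiction *)

(** The degree of [e_a]. *)
Definition level_idx a : F := (inj_idx a)%:R - (inj_idx (opp a))%:R.

Definition grading m : M :=
  \sum_(k < n) level_idx (lshift n k) *: h k m.

Fact grading_linear : linear grading.
Proof.
move=> r u v; rewrite /grading scaler_sumr -big_split; apply: eq_bigr => k _ /=.
by rewrite linearP scalerDr !scalerA mulrC.
Qed.
HB.instance Definition _ := GRing.isLinear.Build F M M _ grading grading_linear.

Lemma gradingB u v : grading (u - v) = grading u - grading v.
Proof. exact: linearB. Qed.

Lemma gradingZ (r : F) u : grading (r *: u) = r *: grading u.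
Proof. exact: linearZ. Qed.

Lemma level_idx_wt a :
  \sum_(k < n) level_idx (lshift n k) * wt F a k = level_idx a.
Proof.
case: (split_ordP a) => i ->; rewrite (bigD1 i) //= big1 /wt.
- by rewrite eqxx eq_lrshift subr0 mulr1 addr0.
- by move=> k ne; rewrite eq_lshift eq_lrshift eq_sym (negPf ne) subr0 mulr0.
- rewrite eqxx eq_rlshift sub0r mulrN1 addr0 /level_idx opprB.
  by rewrite opp_idx_lshift opp_idx_rshift.
- by move=> k ne; rewrite eq_rshift eq_rlshift eq_sym (negPf ne) subr0 mulr0.
Qed.

Lemma grading_e a m : grading (e a m) = e a (grading m) + level_idx a *: e a m.
Proof.
rewrite /grading linear_sum -level_idx_wt scaler_suml -big_split.
by apply: eq_bigr => k _ /=; rewrite h_e scalerDr scalerA linearZ.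
Qed.

Lemma grading_s a b m :
  grading (s a b m) = s a b (grading m) + (level_idx a + level_idx b) *: s a b m.
Proof.
rewrite /grading linear_sum -!level_idx_wt -big_split scaler_suml -big_split.
by apply: eq_bigr => k _ /=; rewrite h_s scalerDr scalerA mulrDr linearZ.
Qed.

Lemma grading_weight mu m : weight_vector mu m ->
  grading m = (\sum_(k < n) level_idx (lshift n k) * mu k) *: m.
Proof.
move=> mum; rewrite /grading scaler_suml; apply: eq_bigr => k _.
by rewrite mum scalerA.
Qed.

(** [level_op g N] is [\prod_(1 <= k <= N) (grading - (g + k))]: its kernel is the
    sum of the eigenspaces of the degrees [g + 1], ..., [g + N], which is how
    living in degrees greater than [g] is expressed. *)
Fixpoint level_op (g : F) (N : nat) m : M :=
  if N is N'.+1 then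
    grading (level_op g N' m) - (g + N%:R) *: level_op g N' m
  else m.

Lemma level_op_linear g N (k : F) u v :
  level_op g N (k *: u + v) = k *: level_op g N u + level_op g N v.
Proof.
elim: N => //= N ->; rewrite linearP scalerBr scalerDr opprD addrACA.
by rewrite !scalerA [k * _]mulrC.
Qed.

Lemma level_op_le0 g N N' m : (N <= N')%N ->
  level_op g N m = 0 -> level_op g N' m = 0.
Proof.
move/subnK <-; elim: (N' - N)%N => // k IH N0.
by rewrite addSn /= IH // linear0 scaler0 subr0.
Qed.

Lemma level_op_shift (x : {linear M -> M}) (g r : F) N m :
    (forall u, grading (x u) = x (grading u) + r *: x u) ->
  level_op g N (x m) = x (level_op (g - r) N m).
Proof.
move=> xd; elim: N => //= N ->; rewrite xd [RHS]linearB /= [x (_ *: _)]linearZ.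
rewrite -addrA -scalerBl -scaleNr; congr (_ + _ *: _); ring.
Qed.

(** Lowering [g] by one adds the factor [grading - g] to the product, and the
    factors commute. *)
Lemma level_opS0 g N m : level_op g N m = 0 -> level_op (g - 1) N.+1 m = 0.
Proof.
have -> : level_op (g - 1) N.+1 m =
    grading (level_op g N m) - g *: level_op g N m.
  elim: N => [|N IH]; first by rewrite /= subrK.
  have -> : level_op (g - 1) N.+2 m = grading (level_op (g - 1) N.+1 m)
      - (g - 1 + N.+2%:R) *: level_op (g - 1) N.+1 m by [].
  have -> : g - 1 + N.+2%:R = g + N.+1%:R.
    by rewrite -addrA [N.+2%:R]mulrS addKr.
  rewrite IH /=; move: (level_op g N m) (g + N.+1%:R) => u r.
  rewrite !gradingB !gradingZ !scalerBr !opprB !scalerA [g * r]mulrC.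
  by rewrite addrACA [RHS]addrACA [X in _ + X]addrC.
by move=> ->; rewrite linear0 scaler0 subrr.
Qed.

(** The submodule generated by the lowest vectors of degree greater than [g];
    only the operators of positive degree are allowed as generators, so that the
    bound on degrees is evident, and raised_submodule proves that the others
    lead nowhere new. *)
Inductive raised (g : F) : M -> Prop :=
| raised_lowest k m : lowest_vector m -> grading m = (g + k.+1%:R) *: m ->
    raised g m
| raised_linear (r : F) u v : raised g u -> raised g v -> raised g (r *: u + v)
| raised_s a b m : inj_idx a -> ~~ inj_idx (opp b) -> raised g m ->
    raised g (s a b m).

Lemma raised_level g m : raised g m -> exists N, level_op g N m = 0.
Proof.
elim=> {m} [k m _ mk|r u v _ [N uN] _ [N' vN]|a b m ia nb' _ [N mN]].
- exists k.+1 => /=.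
  have gk l : grading (level_op g l m) = (g + k.+1%:R) *: level_op g l m.
    elim: l => //= l IH; rewrite gradingB gradingZ IH gradingZ IH.
    by rewrite scalerBr !scalerA [_ * (g + l.+1%:R)]mulrC.
  by rewrite gk subrr.
- exists (maxn N N'); rewrite level_op_linear.
  rewrite (level_op_le0 (leq_maxl N N') uN) (level_op_le0 (leq_maxr N N') vN).
  by rewrite scaler0 addr0.
have := level_op_shift g _ m (grading_s a b).
rewrite /level_idx ia (negPf nb') inj_idx_opp // !subr0.
case: (inj_idx b) => shift; [exists N.+2|exists N.+1]; rewrite shift.
  by rewrite opprD addrA !level_opS0 ?linear0.
by rewrite addr0 level_opS0 ?linear0.
Qed.

Lemma lowest_vector_e a m : lowest_vector m -> lowest_vector (e a m).
Proof.
case=> mK mC; split; first exact: null_vector_e.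
move=> i b ii nb; rewrite s_e mC // linear0 add0r.
by rewrite !mK ?inj_idx_opp // !scaler0 addr0.
Qed.

(** The hypotheses on [a] and [b] say that [s_ab] has degree zero and maps each
    of the three classes of indices, those in [I], those paired with [I], and
    the others, into itself. *)
Lemma lowest_vector_s a b m :
    inj_idx a = inj_idx (opp b) -> inj_idx b = inj_idx (opp a) ->
  lowest_vector m -> lowest_vector (s a b m).
Proof.
move=> ab ba [mK mC].
have om_term c d (u : M) : (d = opp c -> u = 0) -> om c d *: u = 0.
  move=> u0; have [dc|ne] := eqVneq d (opp c); first by rewrite u0 ?scaler0.
  by rewrite om_eq0 ?scale0r.
split=> [f nf|i d ii nd].
  have := s_e a b f m; rewrite mK // linear0 !om_term ?addr0 // => fE.
  - by rewrite mK // ab -fE.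
  - by rewrite mK // ba -fE.
rewrite s_s mC // linear0 add0r !om_term ?addr0 // => cE.
- by rewrite s_sym mC // ab cE opp_idxK.
- by rewrite -[a]opp_idxK mC // -ba cE opp_idxK.
- by rewrite mC // ba cE opp_idxK.
- by rewrite s_sym -[b]opp_idxK mC // -ab cE opp_idxK.
Qed.

Lemma raised0 g : raised g 0.
Proof.
apply: (@raised_lowest _ 0); last by rewrite scaler0; exact: (linear0 grading).
by split=> [f _|i b _ _]; rewrite linear0.
Qed.

(** For an arbitrary [y] in the algebra, [y s_ab m = s_ab y m + [y, s_ab] m]
    reduces the stability under [y] to that of shorter vectors, hence to the
    lowest vectors, on which it is checked for each basis element. *)
Lemma raised_submodule g : submodule (raised g).
Proof.
have r0 := raised0 g; split=> [||y m gm] //; first exact: raised_linear.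
elim: gm y => {m} [k m mQ mk|r u v _ IHu _ IHv|a b m ia nb' gm IH] y; last first.
- have -> : act y (s a b m) = s a b (act y m) +
      act (lieb y (sp_in (sym2 (ev F a) (ev F b)))) m by exact: act_swap.
  rewrite -[s a b _]scale1r; apply: raised_linear (IH _).
  by apply: raised_s ia nb' (IH y).
- by rewrite linearP; exact: (raised_linear r (IHu y) (IHv y)).
have gm : raised g m by apply: raised_lowest mQ mk.
move: y; apply: gn_span => [|r x y gx gy||a|a b].
- by rewrite act0l.
- by rewrite act_linearl; apply: raised_linear.
- by rewrite z_act0.
- rewrite -/(e a m); have [ia|na] := boolP (inj_idx a); last by rewrite mQ.1.
  apply: (@raised_lowest _ k.+1); first exact: lowest_vector_e.
  rewrite grading_e mk /level_idx ia inj_idx_opp // subr0 linearZ -scalerDl.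
  by rewrite [k.+2%:R]mulrSr addrA.
rewrite -/(s a b m).
have level0 c d : inj_idx c = inj_idx (opp d) -> inj_idx d = inj_idx (opp c) ->
    raised g (s c d m).
  move=> cd dc; apply: (@raised_lowest _ k); first exact: lowest_vector_s.
  by rewrite grading_s mk /level_idx cd dc subrKA subrr scale0r addr0 linearZ.
have mixed c d : inj_idx c -> raised g (s c d m).
  move=> ic; have [id'|nd'] := boolP (inj_idx (opp d)); last exact: raised_s.
  apply: level0; first by rewrite ic id'.
  by rewrite inj_idx_opp // -[d]opp_idxK inj_idx_opp.
have [ia|na] := boolP (inj_idx a); first exact: mixed.
have [ib|nb] := boolP (inj_idx b); first by rewrite s_sym; apply: mixed.
have [ia'|na'] := boolP (inj_idx (opp a)).
  by rewrite -[a]opp_idxK mQ.2.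
have [ib'|nb'] := boolP (inj_idx (opp b)).
  by rewrite s_sym -[b]opp_idxK mQ.2.
by apply: level0; rewrite ?(negPf na) ?(negPf nb) ?(negPf na') ?(negPf nb').
Qed.

Lemma inj_idx_false a : ~~ inj_idx a.
Proof.
apply/negP => ia; have [mu [q nzq [muq qQ]]] := lowest_vector_exists.
set g := \sum_(k < n) level_idx (lshift n k) * mu k.
have qg : grading q = g *: q := grading_weight muq.
have eqr : raised g (e a q).
  apply: (@raised_lowest _ 0); first exact: lowest_vector_e.
  by rewrite grading_e qg /level_idx ia inj_idx_opp // subr0 linearZ -scalerDl.
have [_ /(_ _ (raised_submodule g)) [r0|rT]] := simM.
  have : [set 0]%classic (e a q) by rewrite -r0.
  by move/(inj_idxP ia)/eqP; rewrite (negPf nzq).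
have /raised_level[N] : raised g q by rewrite rT.
(* On [q], of degree [g], the factors are the nonzero scalars [- k]. *)
suff [r nzr ->] : exists2 r, r != 0 & level_op g N q = r *: q.
  by move/eqP; rewrite scaler_eq0 (negPf nzr) (negPf nzq).
elim: N => [|N [r nzr IH]]; first by exists 1; rewrite ?oner_eq0 ?scale1r.
exists (- N.+1%:R * r); first by rewrite mulf_neq0 // oppr_eq0 pnatr_eq0.
rewrite /= IH gradingZ qg !scalerA -scalerBl; congr (_ *: _).
ring.
Qed.

Lemma vec_act0 v m : act (vec v) m = 0.
Proof.
have [||||q [nzq _ q0]] := @common_kernel _ _ M setT _ (enum 'I_(n + n))
    (fun a => vec (ev F a)).
- by case: weightE => mu [u nzu _]; exists u.
- by [].
- by move=> a u _ _; apply/noninj_nilpotent/inj_idx_false.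
- by move=> a b u _ _ _; apply: e_comm.
pose U : set M := [set m | forall a, e a m = 0]%classic.
have subU : submodule U.
  apply: submodule_gen => [a|k u w u0 w0 a|a u u0 b|a b u u0 c].
  - exact: linear0.
  - by rewrite linearP /= u0 w0 scaler0 addr0.
  - by rewrite [LHS]e_comm u0 linear0.
  - have := s_e a b c u; rewrite !u0 !scaler0 !addr0 linear0 => /esym.
    exact.
have [_ /(_ _ subU) [U0|UT]] := simM.
  have : [set 0]%classic q by rewrite -U0 => a; apply: q0; rewrite mem_enum.
  by move/eqP; rewrite (negPf nzq).
have Um : U m by rewrite UT.
rewrite [v]matrix_sum_delta.
apply: (big_ind (fun w => act (vec w) m = 0)) => [|u w u0 w0|a _].
- exact: act0l.
- by rewrite vecD actDl u0 w0 addr0.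
by rewrite big_ord1 vecZ actZl [X in _ *: X](Um a) scaler0.
Qed.

End SimpleModule.

(** * Weights over the two Cartan subalgebras *)

(** [ext] need not be onto: an index outside its image has a zero summand. *)
Lemma is_direct_sum_reindex (F : fieldType) (L : lieAlgType F)
    (M : lieModule L) (I J : eqType) (E : I -> set M) (E' : J -> set M)
    (ext : J -> I) (res : I -> J) :
    cancel ext res -> (forall j m, E' j m <-> E (ext j) m) ->
    (forall i m, E i m -> m != 0 -> ext (res i) = i) -> (forall i, E i 0) ->
  is_direct_sum E -> is_direct_sum E'.
Proof.
move=> extK EE' resK E0 [sumE directE]; split=> [m|s f uniq_s fE sum0 j js].
  have [s [f [uniq_s fE ->]]] := sumE m.
  pose s' := [seq i <- s | f i != 0].
  have resK' i : i \in s' -> ext (res i) = i.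
    by rewrite mem_filter => /andP[nz_fi _]; apply: resK (fE i) nz_fi.
  exists [seq res i | i <- s'], (f \o ext); split=> [|j|].
  - rewrite map_inj_in_uniq ?filter_uniq // => i i' /resK' <- /resK' <-.
    by rewrite !extK => ->.
  - by apply: (EE' _ _).2; apply: fE.
  rewrite big_map big_filter [RHS]big_mkcond /=; apply: eq_bigr => i _.
  have [// |nz] := eqVneq (f i) 0; rewrite /= (resK _ _ (fE i) nz) //.
pose f' i := if ext (res i) == i then f (res i) else 0.
have f'ext k : f' (ext k) = f k by rewrite /f' extK eqxx.
rewrite -f'ext; apply: (directE [seq ext k | k <- s]).
- by rewrite (map_inj_uniq (can_inj extK)).
- move=> i; rewrite /f'; case: eqP => [ei|_]; last exact: E0.
  by rewrite -[X in E X]ei; apply: (EE' _ _).1; apply: fE.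
- by rewrite big_map -[RHS]sum0; apply: eq_bigr => k _; apply: f'ext.
- exact: map_f.
Qed.

Section CartanWeights.
Variables (F : numFieldType) (n : nat) (M : lieModule (gn F n)).
Hypothesis z_act0 : forall m : M, act (gn_z F n) m = 0.

Notation hg := (gn_cartan F n).
Notation hs := (sp_cartan F n).

Lemma gn_cartanP (x : gn F n) : x \in hg ->
  exists2 y, y \in hs & exists c, x = sp_in y + c *: gn_z F n.
Proof.
case/memv_addP=> _ /memv_imgP[y ys ->] [_ /vlineP[c ->] ->].
by exists y => //; exists c; rewrite lfunE.
Qed.

Lemma sp_in_cartan y : y \in hs -> sp_in y \in hg.
Proof.
move=> ys; apply: (subvP (addvSl _ _)).
by rewrite -[sp_in y](lfunE _ y) memv_img.
Qed.

Lemma gn_z_cartan : gn_z F n \in hg.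
Proof. by apply: (subvP (addvSr _ _)); rewrite memv_line. Qed.

Definition ext_weight_fun (mu : 'Hom(subvs_of hs, F^o))
    (x : subvs_of hg) : F^o :=
  mu (vsproj hs (vsval x).1).

Fact ext_weight_linear mu : linear (ext_weight_fun mu).
Proof. by move=> r x y; rewrite /ext_weight_fun !linearP. Qed.
HB.instance Definition _ mu :=
  GRing.isLinear.Build F (subvs_of hg) F^o _ (ext_weight_fun mu)
    (ext_weight_linear mu).

Definition ext_weight mu : 'Hom(subvs_of hg, F^o) := linfun (ext_weight_fun mu).

Definition res_weight_fun (la : 'Hom(subvs_of hg, F^o))
    (y : subvs_of hs) : F^o :=
  la (vsproj hg (sp_in (vsval y))).

Fact res_weight_linear la : linear (res_weight_fun la).
Proof. by move=> r x y; rewrite /res_weight_fun !linearP. Qed.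
HB.instance Definition _ la :=
  GRing.isLinear.Build F (subvs_of hs) F^o _ (res_weight_fun la)
    (res_weight_linear la).

Definition res_weight la : 'Hom(subvs_of hs, F^o) := linfun (res_weight_fun la).

Lemma ext_weightK : cancel ext_weight res_weight.
Proof.
move=> mu; apply/lfunP => y; rewrite lfunE /= /res_weight_fun lfunE /=.
by rewrite /ext_weight_fun vsprojK ?sp_in_cartan ?subvsP //= vsvalK.
Qed.

Lemma ext_weightE mu (x : subvs_of hg) y (ys : y \in hs) (c : F) :
  vsval x = sp_in y + c *: gn_z F n -> ext_weight mu x = mu (Subvs ys).
Proof.
move=> xE; rewrite lfunE /= /ext_weight_fun; congr (mu _).
have -> : (vsval x).1 = y by rewrite xE /= scaler0 addr0.
by apply: val_inj; rewrite /= vsprojK.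
Qed.

Lemma weight_space_ext mu (m : M) :
  weight_space (M := res_sp M) mu m <-> weight_space (ext_weight mu) m.
Proof.
split=> wm x.
  have [y ys [c xE]] := gn_cartanP (subvsP x).
  rewrite (ext_weightE mu ys xE) xE actDl actZl z_act0 scaler0 addr0.
  exact: (wm (Subvs ys)).
have xg := sp_in_cartan (subvsP x).
have := wm (Subvs xg); rewrite (ext_weightE mu (subvsP x) (c := 0)).
  by rewrite (_ : Subvs _ = x) //; apply: val_inj.
by rewrite scale0r addr0.
Qed.

(** A nonzero weight vector forces the weight to vanish on [z]. *)
Lemma weight_spaceE (la : 'Hom(subvs_of hg, F^o)) (m : M) :
  weight_space la m -> m != 0 -> ext_weight (res_weight la) = la.
Proof.
move=> wm nzm; have la_z : la (Subvs gn_z_cartan) = 0.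
  have /eqP := wm (Subvs gn_z_cartan); rewrite z_act0 eq_sym.
  by rewrite scaler_eq0 (negPf nzm) orbF => /eqP.
apply/lfunP => x; have [y ys [c xE]] := gn_cartanP (subvsP x).
rewrite (ext_weightE _ ys xE) lfunE /= /res_weight_fun /=.
have -> : x = vsproj hg (sp_in y) + c *: Subvs gn_z_cartan.
  apply: subvs_inj; rewrite linearD linearZ /= vsprojK ?sp_in_cartan //.
by rewrite linearD linearZ /= la_z scaler0 addr0.
Qed.

Lemma weight_space0 (la : 'Hom(subvs_of hg, F^o)) : weight_space la (0 : M).
Proof. by move=> x; rewrite linear0 scaler0. Qed.

Lemma harish_chandra_res :
  harish_chandra M hg -> harish_chandra (res_sp M) hs.
Proof.
case=> wM fdM; split; last first.
  move=> mu; have [s sE] := fdM (ext_weight mu); exists s => m.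
  exact: iff_trans (weight_space_ext mu m) (sE m).
exact: (is_direct_sum_reindex ext_weightK weight_space_ext weight_spaceE
  weight_space0 wM).
Qed.

(** The first [n] diagonal entries are the coordinates in the basis [h_k]. *)
Definition diag_weight_fun (mu : 'I_n -> F) (y : subvs_of hs) : F^o :=
  \sum_(k < n) mu k * vsval (vsval y) (lshift n k) (lshift n k).

Fact diag_weight_linear mu : linear (diag_weight_fun mu).
Proof.
move=> r x y; rewrite /diag_weight_fun scaler_sumr -big_split.
apply: eq_bigr => k _ /=.
by rewrite !mxE mulrDr mulrCA.
Qed.
HB.instance Definition _ mu :=
  GRing.isLinear.Build F (subvs_of hs) F^o _ (diag_weight_fun mu)
    (diag_weight_linear mu).

Definition diag_weight mu : 'Hom(subvs_of hs, F^o) :=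
  linfun (diag_weight_fun mu).

Lemma sp_h_cartan k : sp_h F k \in hs.
Proof. by apply/memv_span/mapP; exists k; rewrite ?mem_enum. Qed.

Lemma diag_weight_h mu k : diag_weight mu (Subvs (sp_h_cartan k)) = mu k.
Proof.
rewrite lfunE /= /diag_weight_fun (bigD1 k) //= big1 ?addr0 => [|l ne_lk].
  by rewrite !mxE !eqxx eq_lrshift subr0 mulr1.
by rewrite !mxE eq_lshift eq_lrshift (negPf ne_lk) subr0 mulr0.
Qed.

Lemma diag_weight_space mu (m : M) :
  weight_space (M := res_sp M) (diag_weight mu) m <-> weight_vector mu m.
Proof.
split=> [wm k|mum x].
  by rewrite -(diag_weight_h mu k); apply: (wm (Subvs (sp_h_cartan k))).
have xs := subvsP x.
pose X := in_tuple [seq sp_h F k | k : 'I_n].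
have xE : x = \sum_i coord X i (vsval x) *: vsproj hs X`_i.
  apply: subvs_inj; rewrite linear_sum {1}(coord_span (X := X) xs).
  apply: eq_bigr => i _; rewrite linearZ /= vsprojK //.
  by apply/memv_span/mem_nth/(ltn_ord i).
have Xm (i : 'I_(size [seq sp_h F k | k : 'I_n])) :
    act (l := res_sp M) (vsval (vsproj hs X`_i)) m =
    (diag_weight mu (vsproj hs X`_i) : F) *: m.
  have /mapP[k _ ->] : X`_i \in X by apply/mem_nth/(ltn_ord i).
  have -> : vsproj hs (sp_h F k) = Subvs (sp_h_cartan k).
    by apply: subvs_inj; rewrite vsprojK ?sp_h_cartan.
  by rewrite diag_weight_h; exact: mum.
rewrite {1}xE {2}xE !linear_sum act_suml scaler_suml; apply: eq_bigr => i _.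
set r := coord X i (vsval x); set y := vsproj hs X`_i.
transitivity (act (l := res_sp M) (r *: vsval y) m).
  by congr (act _ m); exact: linearZ.
rewrite actZl Xm scalerA; congr (_ *: _).
by rewrite [RHS]linearZ.
Qed.

End CartanWeights.

Lemma heis_act0 (F : numFieldType) (n : nat) (M : lieModule (gn F n)) :
    simple_module M -> harish_chandra M (gn_cartan F n) ->
    (forall m : M, act (gn_z F n) m = 0) ->
  forall (a : heis F n) (m : M), act (heis_in a) m = 0.
Proof.
move=> simM hcM z0 [v c] m.
have [wM fdM] := harish_chandra_res z0 hcM.
rewrite [heis_in _]gn_decomp !actDl actZl z0 scaler0 addr0.
rewrite [X in X + _]act0l add0r.
apply: vec_act0 => // [mu|].
  have [s sE] := fdM (diag_weight mu); exists s => u.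
  exact: iff_trans (iff_sym (diag_weight_space mu u)) (sE u).
have [[m0 nz_m0] _] := simM; have [s [f [_ fW m0E]]] := wM.1 m0.
have [mu nz_f] : exists mu, f mu != 0.
  apply: contrapT => /forallNP f0; case/eqP: nz_m0; rewrite m0E.
  by rewrite big1 // => mu _; apply/eqP/negbNE/negP/f0.
exists (fun k => mu (Subvs (sp_h_cartan F k))), (f mu) => // k.
exact: (fW mu (Subvs (sp_h_cartan F k))).
Qed.

Lemma simple_res_sp (F : numFieldType) (n : nat) (M : lieModule (gn F n)) :
    (forall (a : heis F n) (m : M), act (heis_in a) m = 0) ->
  simple_module M -> simple_module (res_sp M).
Proof.
move=> heis0 [nzM simM]; split=> // U [U0 UD UX]; apply: simM; split=> //.
move=> [X a] u Uu; have -> : (X, a) = sp_in X + heis_in a :> gn F n.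
  by congr (_, _); rewrite /= ?addr0 ?add0r.
by rewrite actDl heis0 addr0; apply: UX.
Qed.

Local Open Scope complex_scope.

Theorem theorem14 (R : realType) (n : nat) (M : lieModule (gn R[i] n)) :
  (1 <= n)%N ->
  simple_module M ->
  harish_chandra M (gn_cartan R[i] n) ->
  (forall m : M, act (gn_z R[i] n) m = 0) ->
  (forall (a : heis R[i] n) (m : M), act (heis_in a) m = 0) /\
  (simple_module (res_sp M) /\
   harish_chandra (res_sp M) (sp_cartan R[i] n)).
Proof.
move=> _ simM hcM z0; have heis0 := heis_act0 simM hcM z0.
split=> //; split; first exact: simple_res_sp.
exact: harish_chandra_res.
Qed.
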